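(* Let $k\ge 1$ be an integer, let $G$ be the $(2k+1)\times(2k+1)$ grid graph, and for a vertex $h$ let $a(2k+1;h)$ be the number of near-perfect matchings of $G$ with $h$ unmatched. Suppose that $a(2k+1;h)$ is a multiple of $2^{k+1}$ for every vertex $h$ that lies on the central row or the central column of $G$ but is not the center vertex. Then the total number $a(2k+1)$ of near-perfect matchings of $G$ satisfies $a(2k+1)=2^k c_k$ where $c_k\equiv 1 \pmod 8$.
   Context: The $m\times n$ grid graph has vertex set $\{1,\dots,m\}\times\{1,\dots,n\}$, with two vertices adjacent when they differ by $1$ in exactly one coordinate. For a graph with an odd number of vertices, a near-perfect matching is a set of pairwise disjoint edges covering all vertices but one; the uncovered vertex is the hole. The central row of the $(2k+1)\times(2k+1)$ grid is $\{(k+1,j)\}$, the central column is $\{(i,k+1)\}$, and the center vertex is $(k+1,k+1)$. *)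

(* Defs.v *)
From mathcomp Require Import all_boot.

Set Implicit Arguments.
Unset Strict Implicit.
Unset Printing Implicit Defensive.

Section Matchings.

Variables (T : finType) (e : rel T).

Definition edges : {set {set T}} :=
  [set E : {set T} | [exists x, exists y, e x y && (E == [set x; y])]].

Definition matching (M : {set {set T}}) : bool :=
  (M \subset edges) && trivIset M.

Definition near_perfect_matching (M : {set {set T}}) : bool :=
  matching M && (#|~: cover M| == 1).

Definition num_npm : nat := #|[set M | near_perfect_matching M]|.

Definition num_npm_hole (h : T) : nat :=
  #|[set M | near_perfect_matching M & h \notin cover M]|.

End Matchings.

Definition consecutive (i j : nat) : bool := (i.+1 == j) || (j.+1 == i).

(* Coordinates are shifted to start at 0: the pair (i, j) stands for the
   vertex (i + 1, j + 1) of {1, ..., m} x {1, ..., n}. *)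
Definition grid (m n : nat) : rel ('I_m * 'I_n) :=
  fun u v => (consecutive u.1 v.1 && (u.2 == v.2))
          || ((u.1 == v.1) && consecutive u.2 v.2).
Arguments grid : clear implicits.

Definition odd_grid (k : nat) : rel ('I_(2 * k + 1) * 'I_(2 * k + 1)) :=
  grid (2 * k + 1) (2 * k + 1).
Arguments odd_grid : clear implicits.

(* With coordinates starting at 0, the central coordinate k + 1 becomes k. *)
Definition central_row (k : nat) : {set 'I_(2 * k + 1) * 'I_(2 * k + 1)} :=
  [set h : 'I_(2 * k + 1) * 'I_(2 * k + 1) | h.1 == k :> nat].

Definition central_column (k : nat) : {set 'I_(2 * k + 1) * 'I_(2 * k + 1)} :=
  [set h : 'I_(2 * k + 1) * 'I_(2 * k + 1) | h.2 == k :> nat].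

Definition is_center (k : nat) (h : 'I_(2 * k + 1) * 'I_(2 * k + 1)) : bool :=
  (h.1 == k :> nat) && (h.2 == k :> nat).

(* Main.v *)
(** Let [a h] be the number of near-perfect matchings with hole [h].  Reflecting a
    matching [m] in the main diagonal gives a second matching [m'], and the union
    of the two is a disjoint union of cycles, doubled edges and one path through
    the hole.  Exactly one diagonal vertex lies on the path; the others lie, two by
    two, on [k] cycles that the reflection preserves.  Exchanging [m] and [m'] on
    any of these cycles shows that the matchings with hole [h] fall into classes of
    size [2 ^ k].  If [h] lies on the antidiagonal but is not the center, the
    antidiagonal reflection permutes the classes without fixing any, so
    [2 ^ (k + 1)] divides [a h].  With the hypothesis on the axes and the
    symmetries of the square, only the center contributes modulo [2 ^ (k + 3)].

    If the hole is the center, a cycle through the diagonal vertices [p] and [q]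
    encloses an even number of vertices other than the center, so the number of
    such diagonal vertices between [p] and [q] is even.  Hence the non-central
    diagonal vertices can be coloured alternately so that each cycle joins the two
    colours, and each class contains exactly one matching in which one colour is
    matched above the diagonal and the other colour below it.  Such a matching is a
    pair of matchings of two congruent regions, so [a center = 2 ^ k * r ^ 2].
    Finally [r] is odd, since the adjacency matrix of the region is invertible
    over [F_2]: its kernel consists of solutions of the discrete wave equation,
    which have the d'Alembert form [psi (b - a) + psi (a + b)]. *)
Require Import Defs.
From mathcomp Require Import all_boot all_fingroup all_algebra.
From mathcomp Require Import zify ring.

Set Implicit Arguments.
Unset Strict Implicit.
Unset Printing Implicit Defensive.

(** * Matchings as involutions *)

(** The points moved by [f] split into pairs {x, f x}; the induction removes one pair at a time. *)
Lemma odd_card_invol (T : finType) (S : {set T}) (f : T -> T) :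
  {in S, forall x, f x \in S} -> {in S, forall x, f (f x) = x} ->
  odd #|S| = odd #|[set x in S | f x == x]|.
Proof.
elim: {S}#|S| {-2}S (leqnn #|S|) => [|N IH] S leS fS fK.
  have -> : S = set0 by apply/eqP; rewrite -cards_eq0 -leqn0.
  by congr (odd _); apply: eq_card => x; rewrite !inE.
have [fixS|] := boolP [forall x in S, f x == x].
  congr (odd _); apply: eq_card => x; rewrite !inE.
  by case xS: (x \in S) => //=; rewrite (forall_inP fixS).
rewrite negb_forall_in => /exists_inP[x xS fx].
have fxS : f x \in S by apply: fS.
have cS : #|S| = #|S :\: [set x; f x]|.+2.
  have sub : [set x; f x] \subset S by rewrite subUset !sub1set xS.
  by rewrite -(cardsID [set x; f x] S) (setIidPr sub) cards2 (eq_sym x) fx.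
have inD y : (y \in S :\: [set x; f x]) = [&& y \in S, y != x & y != f x].
  by rewrite !inE negb_or andbC.
rewrite cS /= negbK IH.
- congr (odd _); apply: eq_card => y; rewrite !inE.
  have [->|yx] := eqVneq y x; first by rewrite /= (negPf fx) andbF.
  have [->|yf] := eqVneq y (f x); last by [].
  by rewrite /= fK // eq_sym (negPf fx) andbF.
- by rewrite cS ltnS in leS; apply: leq_trans leS.
- move=> y; rewrite !inD => /and3P[yS yx yf]; rewrite fS //=.
  apply/andP; split; first by apply: contra yf => /eqP <-; rewrite fK.
  by apply: contra yx => /eqP e; rewrite -(fK y) // e fK.
- by move=> y; rewrite inD => /and3P[yS _ _]; rewrite fK.
Qed.

Section Involutions.

Variables (V : finType) (e : rel V).
Hypothesis (e_sym : symmetric e) (e_irr : irreflexive e).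

(* A perfect matching of the subgraph induced by [Z], encoded as the involution
   exchanging matched vertices and fixing the vertices outside [Z]. *)
Definition pm (Z : {set V}) : {set {ffun V -> V}} :=
  [set m : {ffun V -> V} | [forall v, (m (m v) == v) &&
                      (if v \in Z then e v (m v) else m v == v)]].

Lemma pmP (Z : {set V}) (m : {ffun V -> V}) :
  reflect [/\ forall v, m (m v) = v, {in Z, forall v, e v (m v)}
            & forall v, v \notin Z -> m v = v] (m \in pm Z).
Proof.
rewrite inE; apply: (iffP forallP) => [H|[mK mZ mN] v].
  split=> v; first by case/andP: (H v) => /eqP.
    by move=> vZ; have := H v; rewrite vZ => /andP[].
  by move=> vZ; have := H v; rewrite (negPf vZ) => /andP[_ /eqP].
by rewrite mK eqxx /=; case: ifPn => [/mZ//|/mN/eqP].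
Qed.

Lemma pm_inset (Z : {set V}) (m : {ffun V -> V}) v : m \in pm Z -> (m v \in Z) = (v \in Z).
Proof.
move=> /pmP[mK mZ mN].
have H u : u \in Z -> m u \in Z.
  move=> uZ; apply/negPn/negP => /mN; rewrite mK => E.
  by have := mZ _ uZ; rewrite -E e_irr.
by apply/idP/idP => [/H|/H//]; rewrite mK.
Qed.

Definition pairs (Z : {set V}) (m : {ffun V -> V}) : {set {set V}} :=
  [set [set v; m v] | v in Z].

Lemma cover_pairs Z m : m \in pm Z -> cover (pairs Z m) = Z.
Proof.
move=> mP; apply/setP => v; apply/bigcupP/idP => [[B /imsetP[u uZ ->]]|vZ].
  by rewrite !inE => /orP[] /eqP -> //; rewrite (pm_inset _ mP).
by exists [set v; m v]; [apply: (imset_f (fun v => [set v; m v])) | rewrite set21].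
Qed.

Lemma pairs_matching Z m : m \in pm Z -> matching e (pairs Z m).
Proof.
move=> mP; have [mK mZ mN] := pmP _ _ mP; apply/andP; split.
  apply/subsetP => _ /imsetP[v vZ ->]; rewrite inE.
  by apply/existsP; exists v; apply/existsP; exists (m v); rewrite mZ /=.
apply/trivIsetP => _ _ /imsetP[u uZ ->] /imsetP[v vZ ->] neq.
rewrite -setI_eq0; apply: contraR neq => /set0Pn[w].
rewrite !inE => /andP[/orP[] /eqP -> /orP[] /eqP E].
- by rewrite E.
- by rewrite E mK setUC.
- by rewrite -E mK setUC.
- by have -> : u = v by rewrite -(mK u) E mK.
Qed.

Lemma pairs_inj Z : {in pm Z &, injective (pairs Z)}.
Proof.
move=> m m' mP mP' E; have [mK mZ mN] := pmP _ _ mP; have [mK' mZ' mN'] := pmP _ _ mP'.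
apply/ffunP => v; case: (boolP (v \in Z)) => vZ; last by rewrite mN ?mN'.
have : [set v; m v] \in pairs Z m' by rewrite -E (imset_f (fun v => [set v; m v])).
move=> /imsetP[u uZ F].
have nvm : m v != v by apply: contraTneq (mZ _ vZ) => ->; rewrite e_irr.
have : v \in [set u; m' u] by rewrite -F !inE eqxx.
have : m v \in [set u; m' u] by rewrite -F !inE eqxx orbT.
move=> /set2P[] mv /set2P[] vE.
- by rewrite mv vE eqxx in nvm.
- by rewrite vE mK' -vE.
- by rewrite mv -vE.
- by rewrite mv -vE eqxx in nvm.
Qed.

Lemma pairs_surj M : matching e M ->
  exists2 m, m \in pm (cover M) & pairs (cover M) m = M.
Proof.
move=> /andP[/subsetP sM tM].
have blk v : v \in cover M -> exists2 w, e v w & pblock M v = [set v; w].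
  move=> vM; have := pblock_mem vM => /sM; rewrite inE.
  move=> /existsP[x /existsP[y /andP[exy /eqP E]]].
  have : v \in pblock M v by rewrite mem_pblock.
  rewrite E => /set2P[] ->; first by exists y.
  by exists x; rewrite 1?e_sym // setUC.
(* The default [v] never occurs on covered vertices: their block is an edge, and [e] has no
   loops. *)
pose f v := odflt v [pick w in pblock M v | w != v].
have fP v : v \in cover M -> e v (f v) /\ pblock M v = [set v; f v].
  move=> vM; have [w ew E] := blk _ vM; rewrite /f.
  case: pickP => [x|/(_ w)]; rewrite E !inE.
    by case: (x =P v) => [->|_] //=; rewrite ?andbF //= andbT => /eqP ->.
  by rewrite eqxx orbT /= => /negbFE /eqP E'; rewrite E' e_irr in ew.
have fM v : v \in cover M -> f v \in cover M /\ f (f v) = v.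
  move=> vM; have [ev E] := fP _ vM.
  have fvE : f v \in pblock M v by rewrite E !inE eqxx orbT.
  have P : pblock M (f v) = pblock M v by apply: def_pblock => //; apply: pblock_mem.
  have fvM : f v \in cover M by rewrite -mem_pblock P.
  split=> //; have [ev' E'] := fP _ fvM.
  have : v \in pblock M (f v) by rewrite P E !inE eqxx.
  by rewrite E' => /set2P[] // E2; rewrite -E2 e_irr in ev.
exists [ffun v => if v \in cover M then f v else v].
  apply/pmP; split=> v; rewrite !ffunE.
  - case vM: (v \in cover M); last by rewrite vM.
    by have [-> ->] := fM _ vM.
  - by move=> vM; rewrite vM; case: (fP _ vM).
  - by move=> /negPf ->.
apply/setP => B; apply/imsetP/idP => [[v vM ->]|BM].
  by rewrite ffunE vM; case: (fP _ vM) => _ <-; apply: pblock_mem.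
have := sM _ BM; rewrite inE => /existsP[x /existsP[y /andP[exy /eqP E]]].
have xB : x \in B by rewrite E !inE eqxx.
have xM : x \in cover M by apply/bigcupP; exists B.
by exists x => //; rewrite ffunE xM; case: (fP _ xM) => _ <-; rewrite (def_pblock tM BM xB).
Qed.

Lemma num_npm_holeE h : num_npm_hole e h = #|pm (~: [set h])|.
Proof.
rewrite -(card_in_imset (@pairs_inj (~: [set h]))); apply: eq_card => M.
rewrite inE; apply/andP/imsetP => [[/andP[mM /cards1P[x Ex]] hM]|[m mP ->]].
  have cM : cover M = ~: [set h].
    have : h \in ~: cover M by rewrite inE.
    by rewrite Ex inE => /eqP ->; rewrite -Ex setCK.
  by have [m mP <-] := pairs_surj mM; exists m; rewrite -cM.
rewrite /near_perfect_matching pairs_matching // cover_pairs // setCK.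
by split; rewrite ?cards1 // !inE eqxx.
Qed.

Lemma num_npm_sum : num_npm e = \sum_h num_npm_hole e h.
Proof.
rewrite /num_npm -sum1_card.
under [RHS]eq_bigr do rewrite /num_npm_hole -sum1_card.
rewrite (exchange_big_dep (mem [set M | near_perfect_matching e M])) /=.
  apply: eq_bigr => M; rewrite inE => MP.
  have /andP[_ /cards1P[x Ex]] := MP.
  rewrite (eq_bigl (pred1 x)) ?big_pred1_eq // => h.
  by rewrite inE MP -in_setC Ex inE.
by move=> h M _; rewrite !inE => /andP[].
Qed.

Lemma pm_conj (g : V -> V) (Z : {set V}) : involutive g -> (forall u v, e (g u) (g v) = e u v) ->
  #|pm (g @^-1: Z)| = #|pm Z|.
Proof.
move=> gK ge.
pose c (m : {ffun V -> V}) := [ffun v => g (m (g v))].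
have cK : involutive c by move=> m; apply/ffunP => v; rewrite !ffunE !gK.
have cP Y m : m \in pm Y -> c m \in pm (g @^-1: Y).
  move=> /pmP[mK mZ mN]; apply/pmP; split=> v; rewrite ?inE !ffunE.
  - by rewrite gK mK gK.
  - by move=> vY; rewrite -{1}(gK v) ge mZ.
  - by move=> vY; rewrite mN ?gK.
have gg : g @^-1: (g @^-1: Z) = Z by apply/setP => v; rewrite !inE gK.
rewrite -(card_imset _ (inv_inj cK)); apply: eq_card => m.
apply/imsetP/idP => [[m' m'P ->]|mP]; first by rewrite -gg cP.
by exists (c m); rewrite ?cK ?cP.
Qed.

Lemma num_npm_hole_conj (g : V -> V) h : involutive g ->
  (forall u v, e (g u) (g v) = e u v) -> num_npm_hole e (g h) = num_npm_hole e h.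
Proof.
move=> gK ge; rewrite !num_npm_holeE -(pm_conj (~: [set h]) gK ge); congr #|pm _|.
by apply/setP => v; rewrite !inE (can2_eq gK gK).
Qed.

End Involutions.

(** * Flipping the cycles that a reflection preserves *)

Section Reflection.

Variables (V : finType) (e : rel V) (sg : V -> V) (h : V) (k : nat).
Hypothesis (e_irr : irreflexive e) (sgK : involutive sg).
Hypothesis (e_sg : forall u v, e (sg u) (sg v) = e u v).
Let D := [set v | sg v == v].
Hypothesis (D_indep : {in D &, forall u v, ~~ e u v}).
Let M := pm e (~: [set h]).

(* The square of [turn m] is the product of [m] and its mirror image, and the
   orbit of a point fixed by the reflection is its component in their union. *)
Definition turn (m : {ffun V -> V}) (v : V) : V := sg (m v).
Definition comp (m : {ffun V -> V}) (p : V) : {set V} :=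
  [set v | fconnect (turn m) p v].
(** These are the unions of components of [m] and its mirror image that the reflection preserves as
    a whole; on such a set, [flip] exchanges [m] with its mirror image. *)
Definition stable (m : {ffun V -> V}) (X : {set V}) : bool :=
  [forall v in X, (m v \in X) && (sg v \in X)].
Definition flip (X : {set V}) (m : {ffun V -> V}) : {ffun V -> V} :=
  [ffun v => if v \in X then sg (m (sg v)) else m v].

Implicit Types (m : {ffun V -> V}) (X Y : {set V}).

Lemma stableP m X :
  reflect (forall v, v \in X -> m v \in X /\ sg v \in X) (stable m X).
Proof.
by apply: (iffP forall_inP) => H v /H => [/andP[]|[-> ->]].
Qed.

Lemma stable_sg m X v : stable m X -> (sg v \in X) = (v \in X).
Proof. by move=> /stableP H; apply/idP/idP => /H[_]; rewrite ?sgK. Qed.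

Lemma holeP m v : m \in M -> (m v == v) = (v == h).
Proof.
move=> /pmP[_ mZ mN]; apply/eqP/eqP => [E|->]; last by rewrite mN // !inE eqxx.
apply/eqP; apply: contraT => vh.
by have := mZ v; rewrite !inE E e_irr => /(_ vh).
Qed.

Lemma pm_adj m v : m \in M -> v != h -> e v (m v).
Proof. by move=> /pmP[_ mZ _] vh; apply: mZ; rewrite !inE. Qed.

Lemma pm_inv m : m \in M -> involutive m.
Proof. by case/pmP. Qed.

Lemma turn_inj m : m \in M -> injective (turn m).
Proof. by move=> /pm_inv mK; apply: inj_comp; apply: inv_inj. Qed.

(** Being a product of two involutions, [turn m] is conjugated to its inverse by [sg]. *)
Lemma turn_sg m v : m \in M -> turn m (sg (turn m v)) = sg v.
Proof. by move=> /pm_inv mK; rewrite /turn sgK mK. Qed.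

Lemma iter_turn_sg m i v : m \in M ->
  iter i (turn m) (sg (iter i (turn m) v)) = sg v.
Proof. by move=> mM; elim: i v => //= i IH v; rewrite -iterS iterSr turn_sg. Qed.

Lemma fconnect_sg m u v : m \in M ->
  fconnect (turn m) u v -> fconnect (turn m) (sg u) (sg v).
Proof.
move=> mM /iter_findex <-; rewrite fconnect_sym; last exact: turn_inj.
by set i := findex _ _ _; rewrite -(iter_turn_sg i u mM) fconnect_iter.
Qed.

Lemma mem_comp m p : p \in comp m p.
Proof. by rewrite inE connect0. Qed.

Lemma comp_eq m p q : m \in M -> q \in comp m p -> comp m q = comp m p.
Proof.
move=> mM; rewrite inE => pq; apply/setP => v; rewrite !inE.
by apply/esym/same_connect => //; apply: fconnect_sym; apply: turn_inj.
Qed.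

(** The reflection maps the orbit of [p] to the orbit of [sg p = p]; as [m] is [sg] after [turn m],
    the orbit is closed under [m] too. *)
Lemma stable_comp m p : m \in M -> p \in D -> stable m (comp m p).
Proof.
move=> mM; rewrite inE => /eqP pD.
have sgO v : v \in comp m p -> sg v \in comp m p.
  by rewrite !inE -{2}pD; apply: fconnect_sg.
apply/stableP => v vO; split; last exact: sgO.
rewrite -(sgK (m v)); apply: sgO; rewrite !inE in vO *.
by apply: connect_trans vO (fconnect1 _ _).
Qed.

Lemma comp_min m p X : stable m X -> p \in X -> comp m p \subset X.
Proof.
move=> /stableP sX pX; apply/subsetP => v; rewrite inE => /iter_findex <-.
by elim: (findex _ _ _) => //= i /sX[/sX[]].
Qed.

(** The involution [m] acts on the component, and its only possible fixed point there is [h]. *)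
Lemma odd_comp m p : m \in M -> p \in D -> odd #|comp m p| = (h \in comp m p).
Proof.
move=> mM pD; have /stableP sO := stable_comp mM pD.
rewrite (odd_card_invol (f := m)); first last.
- by move=> v _; apply: pm_inv mM v.
- by move=> v /sO[].
case: (boolP (h \in comp m p)) => hO.
  suff -> : [set x in comp m p | m x == x] = [set h] by rewrite cards1.
  apply/setP => v; rewrite in_set1 inE holeP // andbC.
  by case: eqP => // ->.
suff -> : [set x in comp m p | m x == x] = set0 by rewrite cards0.
apply/setP => v; rewrite in_set0 inE holeP // andbC.
by case: eqP => // ->; apply: negbTE.
Qed.

(* On the [turn m]-orbit of [p] the reflection acts as [i |-> - i], so its fixed
   points are [p] and, if the orbit has even length, the opposite point. *)
Lemma comp_fixed m p : m \in M -> p \in D ->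
  if h \in comp m p then comp m p :&: D = [set p]
  else exists2 q, q != p & comp m p :&: D = [set p; q].
Proof.
move=> mM pD; rewrite -odd_comp //.
have -> : #|comp m p| = fingraph.order (turn m) p by apply: eq_card => v; rewrite !inE.
set L := fingraph.order _ _; have L0 : 0 < L by apply: fingraph.order_gt0.
have injt := turn_inj mM.
have iterL : iter L (turn m) p = p by apply: iter_order.
have small i : i < L -> iter i (turn m) p = p -> i = 0.
  by move=> iL E; rewrite -(findex_iter iL) E findex0.
have pfix : sg p = p by apply/eqP; rewrite inE in pD.
(* If [sg] fixes the iterate of order i, then the iterate of order 2i is [p] again, so [L] divides
   2i; with i < L this leaves 0 and L/2. *)
have ifix v : v \in comp m p :&: D -> exists2 i, iter i (turn m) p = v & i = 0 \/ i.*2 = L.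
  rewrite !inE => /andP[cv /eqP vfix]; exists (findex (turn m) p v); first exact: iter_findex.
  have := findex_max cv; have := iter_findex cv; set i := findex _ _ _ => iE iL.
  have : iter (i + i) (turn m) p = p.
    by rewrite iterD iE -{1}vfix -iE iter_turn_sg.
  have [lt|ge] := ltnP (i + i) L => E; first by have := small _ lt E; lia.
  have : iter (i + i - L) (turn m) p = p.
    by rewrite -{2}E -{2}(subnK ge) iterD iterL.
  by move=> /small E'; rewrite -/L in iL; have := E' ltac:(lia); lia.
have pO := mem_comp m p.
case: ifPn => oL.
  apply/setP => v; rewrite [RHS]inE; apply/idP/eqP => [/ifix[i <- [->//|iL]]|->].
    by rewrite -iL odd_double in oL.
  by rewrite inE pO.
pose l := L./2; have lL : l.*2 = L by rewrite /l; lia.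
exists (iter l (turn m) p).
  by apply/eqP => /small E; have := E ltac:(lia); lia.
apply/setP => v; apply/idP/set2P => [/ifix[i <- [->|iL]]|[]->]; first by left.
- by right; congr (iter _ _ _); lia.
- by rewrite inE pO.
rewrite !inE fconnect_iter /=; apply/eqP.
have itinj : injective (iter l (turn m)) by elim: (l) => //= j IH; apply: inj_comp.
by apply: itinj; rewrite iter_turn_sg // pfix -iterD addnn lL iterL.
Qed.

Lemma flip_pm X m : m \in M -> stable m X -> h \notin X -> flip X m \in M.
Proof.
move=> mM sX hX; have mK := pm_inv mM; have sXP := stableP _ _ sX.
apply/pmP; split=> v.
- rewrite !ffunE; case vX : (v \in X).
    have [_ svX] := sXP _ vX; have [msvX _] := sXP _ svX.
    by have [_ ->] := sXP _ msvX; rewrite sgK mK sgK.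
  by case: ifP => [/sXP[]|_]; rewrite mK // vX.
- rewrite !inE ffunE => vh; case: ifPn => vX; last exact: pm_adj.
  rewrite -{1}(sgK v) e_sg; apply: pm_adj => //; apply: contraNneq hX => <-.
  by rewrite (stable_sg _ sX).
- by rewrite !inE negbK ffunE => /eqP ->; rewrite (negPf hX); apply/eqP; rewrite holeP.
Qed.

Lemma stable_flip X Y m : stable m Y -> stable (flip X m) Y.
Proof.
move=> /stableP sY; apply/stableP => v vY; split; last by case: (sY _ vY).
rewrite ffunE; case: ifP => _; last by case: (sY _ vY).
by case: (sY _ vY) => _ /sY[/sY[]].
Qed.

(** On the intersection the mirror image is taken twice, which restores [m], so flips compose by
    symmetric difference. *)
Lemma flip_flip X Y m : stable m X -> stable m Y ->
  flip Y (flip X m) = flip ((X :\: Y) :|: (Y :\: X)) m.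
Proof.
move=> sX sY; apply/ffunP => v; rewrite !ffunE !inE (stable_sg _ sX).
by case: (v \in X); case: (v \in Y); rewrite //= !sgK.
Qed.

Lemma flip0 m : flip set0 m = m.
Proof. by apply/ffunP => v; rewrite ffunE inE. Qed.

Lemma flipK X m : stable m X -> flip X (flip X m) = m.
Proof. by move=> sX; rewrite flip_flip // setDv setU0 flip0. Qed.

(** The component of an axis point is the smallest stable set containing it, and flipping leaves the
    family of stable sets unchanged. *)
Lemma comp_flip X m p : m \in M -> stable m X -> h \notin X -> p \in D ->
  comp (flip X m) p = comp m p.
Proof.
move=> mM sX hX pD; have fM := flip_pm mM sX hX.
apply/eqP; rewrite eqEsubset; apply/andP; split; apply: comp_min; rewrite ?mem_comp //.
  by apply: stable_flip; apply: stable_comp.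
by rewrite -{1}(flipK sX); apply: stable_flip; apply: stable_comp.
Qed.

(** Only components meeting the axis may be exchanged: their number is the same for all matchings,
    so all flip classes have equal size. *)
Definition flippable (m : {ffun V -> V}) : {set {set V}} :=
  [set X : {set V} | [&& stable m X, h \notin X & X \subset \bigcup_(p in D) comp m p]].

Definition flip_class (m : {ffun V -> V}) : {set {ffun V -> V}} :=
  [set flip X m | X in flippable m].

Lemma flippableP m X :
  reflect [/\ stable m X, h \notin X & X \subset \bigcup_(p in D) comp m p]
          (X \in flippable m).
Proof. by rewrite inE; apply: and3P. Qed.

Lemma flippable_flip X m : m \in M -> X \in flippable m ->
  flippable (flip X m) = flippable m.
Proof.
move=> mM /flippableP[sX hX _]; apply/setP => Y; rewrite !inE.
have -> : stable (flip X m) Y = stable m Y.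
  apply/idP/idP => sY; last exact: stable_flip.
  by rewrite -(flipK sX); apply: stable_flip.
by under eq_bigr => p pD do rewrite comp_flip //.
Qed.

Lemma flippable_symdiff X Y m : m \in M -> X \in flippable m -> Y \in flippable m ->
  (X :\: Y) :|: (Y :\: X) \in flippable m.
Proof.
move=> mM /flippableP[sX hX cX] /flippableP[sY hY cY]; apply/flippableP; split.
- apply/stableP => v.
  have mem Z : stable m Z -> (m v \in Z) = (v \in Z).
    by move=> /stableP sZ; apply/idP/idP => /sZ[]; rewrite ?(pm_inv mM).
  by rewrite !inE !(stable_sg _ sX) !(stable_sg _ sY) !mem.
- by rewrite !inE (negPf hX) (negPf hY) andbF.
- by rewrite subUset !(subset_trans (subsetDl _ _)).
Qed.

(** Flippable sets are closed under symmetric difference and are the same for every matching in a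
    class, so the classes are the orbits of a group. *)
Lemma flip_class_eq m N : m \in M -> N \in M ->
  (flip_class N == flip_class m) = (N \in flip_class m).
Proof.
move=> mM NM; apply/eqP/idP => [<-|/imsetP[X Xm ->]].
  apply/imsetP; exists set0; last by rewrite flip0.
  by apply/flippableP; split; rewrite ?inE ?sub0set //; apply/stableP => v; rewrite inE.
have [sX hX _] := flippableP _ _ Xm.
have sub (m' : {ffun V -> V}) : m' \in M -> X \in flippable m' ->
    flip_class (flip X m') \subset flip_class m'.
  move=> m'M Xm'; apply/subsetP => _ /imsetP[Y Ym ->].
  rewrite flippable_flip // in Ym.
  have [sX' _ _] := flippableP _ _ Xm'; have [sY _ _] := flippableP _ _ Ym.
  by rewrite flip_flip //; apply: imset_f; apply: flippable_symdiff.
apply/eqP; rewrite eqEsubset sub //=; rewrite -{1}(flipK sX).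
by apply: sub; rewrite ?flip_pm ?flippable_flip.
Qed.

Lemma flippable_cover m X : m \in M -> X \in flippable m ->
  X = cover [set comp m p | p in X :&: D].
Proof.
move=> mM /flippableP[sX hX cX]; apply/setP => v; apply/idP/bigcupP.
  move=> vX; have /bigcupP[p pD vp] := subsetP cX _ vX.
  exists (comp m p) => //; apply/imsetP; exists p => //.
  rewrite inE pD andbT; apply: (subsetP (comp_min sX vX)).
  by rewrite (comp_eq mM vp) mem_comp.
move=> [_ /imsetP[p /setIP[pX _] ->]]; exact: (subsetP (comp_min sX pX)).
Qed.

(** The mirror image matches [p] with [sg (m p)], which differs from [m p] because no edge joins two
    axis points. Hence a flip reveals the axis points of the flipped set, and by [flippable_cover]
    these determine the set. *)
Lemma flip_moves m X p : m \in M -> X \in flippable m -> p \in D ->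
  (flip X m p == m p) = (p \notin X).
Proof.
move=> mM /flippableP[sX hX cX] pD; rewrite ffunE; case: ifP => pX; last by rewrite eqxx.
have pfix : sg p = p by apply/eqP; rewrite inE in pD.
rewrite pfix; apply/negbTE; apply/negP => E.
have /D_indep : m p \in D by rewrite inE.
move=> /(_ _ pD)/negP[]; rewrite -{2}(pm_inv mM p) pm_adj //.
by apply: contraNneq hX => <-; case: (stableP _ _ sX _ pX).
Qed.

Lemma flip_inj m : m \in M -> {in flippable m &, injective (flip^~ m)}.
Proof.
move=> mM X Y Xm Ym /= E; rewrite (flippable_cover mM Xm) (flippable_cover mM Ym).
suff -> : X :&: D = Y :&: D by [].
apply/setP => p; rewrite !inE.
case pD : (sg p == p); rewrite ?andbF // !andbT.
have {}pD : p \in D by rewrite inE.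
by apply: negb_inj; rewrite -(flip_moves mM Xm pD) E flip_moves.
Qed.

Definition axis_comps (m : {ffun V -> V}) : {set {set V}} :=
  [set comp m p | p in D & h \notin comp m p].

Lemma comp_meet m p q v : m \in M -> v \in comp m p -> v \in comp m q -> comp m p = comp m q.
Proof. by move=> mM vp vq; rewrite -(comp_eq mM vp) (comp_eq mM vq). Qed.

(** Taking unions identifies subfamilies of [axis_comps] with flippable sets; distinct components
    are disjoint, so the union determines the subfamily. *)
Lemma card_flippable m : m \in M -> #|flippable m| = 2 ^ #|axis_comps m|.
Proof.
move=> mM; rewrite -card_powerset.
have inR : {in powerset (axis_comps m) &, injective cover}.
  have sub (A B : {set {set V}}) : A \subset axis_comps m -> B \subset axis_comps m ->
      cover A = cover B -> A \subset B.
    move=> sA sB E; apply/subsetP => C CA.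
    have /imsetP[p _ Cp] := subsetP sA _ CA.
    have : p \in cover B by rewrite -E; apply/bigcupP; exists C; rewrite // Cp mem_comp.
    move=> /bigcupP[C' C'B pC']; have /imsetP[q _ Cq] := subsetP sB _ C'B.
    by rewrite Cp (_ : comp m p = C') // Cq; apply: comp_eq; rewrite -?Cq.
  move=> A B; rewrite !powersetE => sA sB E; apply/eqP.
  by rewrite eqEsubset; apply/andP; split; apply: sub.
rewrite -(card_in_imset inR); apply: eq_card => X; apply/idP/imsetP.
  move=> Xm; have [sX hX _] := flippableP _ _ Xm.
  exists [set comp m p | p in X :&: D]; last exact: flippable_cover.
  rewrite powersetE; apply/subsetP => _ /imsetP[p /setIP[pX pD] ->].
  apply/imsetP; exists p => //; rewrite inE pD /=.
  by apply: contra hX; apply: (subsetP (comp_min sX pX)).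
move=> [A]; rewrite powersetE => /subsetP sA ->.
apply/flippableP; split.
- apply/stableP => v /bigcupP[C CA vC]; have /imsetP[p] := sA _ CA.
  rewrite inE => /andP[pD _] Cp; rewrite Cp in CA vC.
  have [mv sv] := stableP _ _ (stable_comp mM pD) _ vC.
  by split; apply/bigcupP; exists (comp m p).
- apply/bigcupP => -[C CA hC]; have /imsetP[p] := sA _ CA.
  by rewrite inE => /andP[_ hp] Cp; rewrite Cp (negPf hp) in hC.
apply/bigcupsP => C /sA /imsetP[p]; rewrite inE => /andP[pD _] ->.
exact: (bigcup_sup p).
Qed.

Hypothesis D_card : #|D| = k.*2.+1.

(** Each of these components holds two of the 2k + 1 axis points, and at most one axis point shares
    the component of the hole; by parity exactly one does, leaving k pairs. *)
Lemma card_axis_comps m : m \in M -> #|axis_comps m| = k.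
Proof.
move=> mM; pose D' := [set p in D | h \notin comp m p].
have cD' : #|D'| = (#|axis_comps m|).*2.
  rewrite -sum1_card (partition_big_imset (comp m)) /= -muln2 -sum_nat_const.
  apply: eq_bigr => _ /imsetP[p pD' ->].
  have := pD'; rewrite inE => /andP[pD hp].
  have := comp_fixed mM pD; rewrite (negPf hp) => -[q qp E].
  rewrite sum1_card -[RHS](_ : #|[set p; q]| = 2); last by rewrite cards2 eq_sym qp.
  rewrite -E; apply: eq_card => r; rewrite -[LHS]topredE /= in_setI inE.
  apply/andP/andP => [[/andP[rD hr] /eqP <-]|[pr rD]].
    by rewrite rD mem_comp.
  have -> : comp m r = comp m p by apply: comp_eq.
  by rewrite rD eqxx hp.
have : #|D :\: D'| <= 1.
  apply/card_le1_eqP => p q /setDP[pD]; rewrite inE pD /= negbK => hp.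
  move=> /setDP[qD]; rewrite inE qD /= negbK => hq.
  have := comp_fixed mM pD; rewrite hp (comp_meet mM hp hq) => /setP/(_ q).
  by rewrite in_setI mem_comp qD in_set1 => /esym/eqP.
have := cardsID D' D; rewrite (setIidPr _) ?cD' ?D_card; first by lia.
by apply/subsetP => p; rewrite inE => /andP[].
Qed.

Lemma card_flip_class m : m \in M -> #|flip_class m| = 2 ^ k.
Proof.
by move=> mM; rewrite (card_in_imset (flip_inj mM)) card_flippable // card_axis_comps.
Qed.

Lemma flip_class_sub m : m \in M -> flip_class m \subset M.
Proof.
move=> mM; apply/subsetP => _ /imsetP[X /flippableP[sX hX _] ->].
exact: flip_pm.
Qed.

Lemma card_pm_classes : #|M| = #|flip_class @: M| * 2 ^ k.
Proof.
rewrite -sum1_card (partition_big_imset flip_class) /= -sum_nat_const.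
apply: eq_bigr => _ /imsetP[m mM ->]; rewrite sum1_card -(card_flip_class mM).
apply: eq_card => N; rewrite -topredE /=; apply/andP/idP => [[NM]|Nm].
  by rewrite flip_class_eq.
have NM := subsetP (flip_class_sub mM) _ Nm.
by rewrite flip_class_eq.
Qed.

Lemma card_pm_transversal (Y : {set {ffun V -> V}}) : Y \subset M ->
  {in Y &, forall m N, N \in flip_class m -> N = m} ->
  {in M, forall m, exists2 N, N \in Y & N \in flip_class m} ->
  #|M| = #|Y| * 2 ^ k.
Proof.
move=> /subsetP YM Yinj Ysurj; rewrite card_pm_classes; congr (_ * _).
rewrite -(@card_in_imset _ _ flip_class Y).
  apply: eq_card => C; apply/imsetP/imsetP => [[m mM ->]|[m mY ->]]; last by exists m; rewrite ?YM.
  have [N NY Nm] := Ysurj _ mM; exists N => //; apply/esym/eqP.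
  by rewrite flip_class_eq // YM.
move=> m N mY NY E; apply/esym/Yinj => //.
by rewrite -flip_class_eq ?E // YM.
Qed.

(** * A second reflection, which fixes the hole *)

Variable (tau : V -> V).
Hypothesis (tauK : involutive tau) (e_tau : forall u v, e (tau u) (tau v) = e u v).
Hypothesis (tau_sg : forall v, tau (sg v) = sg (tau v)).
Hypothesis (tau_h : tau h = h) (sg_h : sg h != h).
Hypothesis (tau_indep : forall u v, tau u = u -> tau v = v -> ~~ e u v).

Let cj (m : {ffun V -> V}) : {ffun V -> V} := [ffun v => tau (m (tau v))].

Let cjK : involutive cj.
Proof. by move=> m; apply/ffunP => v; rewrite !ffunE !tauK. Qed.

Let cj_pm m : m \in M -> cj m \in M.
Proof.
move=> mM; apply/pmP; split=> v; rewrite ?inE !ffunE.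
- by rewrite tauK (pm_inv mM) tauK.
- move=> vh; rewrite -{1}(tauK v) e_tau pm_adj //.
  by apply: contraNneq vh => E; rewrite -(tauK v) E tau_h.
- by rewrite negbK => /eqP ->; rewrite tau_h; have /eqP -> : m h == h by rewrite holeP.
Qed.

Let turn_cj m v : turn (cj m) (tau v) = tau (turn m v).
Proof. by rewrite /turn ffunE tauK -tau_sg. Qed.

Let cj_class_sub m : m \in M -> cj @: flip_class m \subset flip_class (cj m).
Proof.
move=> mM; apply/subsetP => _ /imsetP[_ /imsetP[X /flippableP[sX hX cX] ->] ->].
apply/imsetP; exists (tau @^-1: X).
  apply/flippableP; split.
  - apply/stableP => v; rewrite !inE ffunE tauK tau_sg => vX.
    exact: (stableP _ _ sX _ vX).
  - by rewrite inE tau_h.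
  - apply/subsetP => v; rewrite inE => /(subsetP cX) /bigcupP[p pD vp].
    apply/bigcupP; exists (tau p).
      by move: pD; rewrite !inE -tau_sg (inj_eq (inv_inj tauK)).
    move: vp; rewrite !inE => /iter_findex E; rewrite -(tauK v) -E.
    elim: (findex _ _ _) => [|i IH]; first exact: connect0.
    by rewrite iterS -turn_cj; apply: connect_trans IH (fconnect1 _ _).
apply/ffunP => v; rewrite !ffunE !inE.
by case: ifP => _; rewrite ?tau_sg.
Qed.

Let cj_class m : m \in M -> cj @: flip_class m = flip_class (cj m).
Proof.
move=> mM; apply/eqP; rewrite eqEsubset cj_class_sub //=.
apply/subsetP => N Nm; rewrite -(cjK N); apply: imset_f.
by have := subsetP (cj_class_sub (cj_pm mM)) _ (imset_f cj Nm); rewrite cjK.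
Qed.

(** Conjugation by [tau] is an involution on the classes. If it fixed the class of [m], the
    conjugate of [m] would be a flip of [m] on a set avoiding [sg h]; then [tau] would fix both
    [sg h] and its mate, although they are adjacent. *)
Lemma even_classes : ~~ odd #|flip_class @: M|.
Proof.
rewrite (odd_card_invol (f := fun C : {set {ffun V -> V}} => cj @: C)).
- suff -> : [set C : {set {ffun V -> V}} in flip_class @: M | cj @: C == C] = set0.
    by rewrite cards0.
  apply/setP => C; rewrite !inE; apply/negbTE/andP => -[/imsetP[m mM ->]].
  rewrite cj_class // flip_class_eq ?cj_pm // => /imsetP[X Xm] /ffunP /(_ (sg h)).
  have [sX hX _] := flippableP _ _ Xm.
  rewrite !ffunE tau_sg tau_h (stable_sg _ sX) (negPf hX) => E.
  have : tau (sg h) = sg h by rewrite tau_sg tau_h.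
  by move=> /tau_indep /(_ E)/negP[]; apply: pm_adj.
- move=> _ /imsetP[m mM ->]; rewrite cj_class //.
  by apply: imset_f; apply: cj_pm.
- by move=> _ /imsetP[m mM ->]; rewrite !cj_class ?cj_pm // cjK.
Qed.

Lemma dvdn_card_pm_twice : 2 ^ k.+1 %| #|M|.
Proof.
by rewrite card_pm_classes expnS dvdn_pmul2r ?expn_gt0 // dvdn2 even_classes.
Qed.

End Reflection.

(** * Symmetries of the grid *)

Lemma sum_fold (T : finType) (F : T -> nat) (g : T -> T) (P Q : pred T) : involutive g ->
  (forall v, F (g v) = F v) -> (forall v, P v = Q v || Q (g v)) ->
  (forall v, ~~ (Q v && Q (g v))) ->
  \sum_(v | P v) F v = 2 * \sum_(v | Q v) F v.
Proof.
move=> gK gF PQ QQ; rewrite (bigID Q) /= mulSn mul1n; congr (_ + _).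
  by apply: eq_bigl => v; rewrite PQ andbC; case: (Q v).
rewrite (reindex_inj (inv_inj gK)) /=; apply: eq_big => // v.
by rewrite PQ gK; have := QQ v; case: (Q v); case: (Q (g v)).
Qed.

(* The implicit type arguments inside [nat_of_ord v.1] vary up to conversion,
   which hides equal atoms from [lia]; abstracting them restores the sharing. *)
Ltac coord_lia :=
  repeat match goal with
    | H : ?T |- _ =>
      lazymatch T with
      | forall x, _ => fail
      | context [nat_of_ord _] => revert H
      end
    end;
  repeat match goal with
    | |- context [nat_of_ord ?x] => move: (nat_of_ord x) => ?
    end; lia.

Section Grid.

Variable k : nat.
Local Notation V := ('I_(2 * k + 1) * 'I_(2 * k + 1))%type.
Local Notation e := (odd_grid k).

Definition transp (v : V) : V := (v.2, v.1).
Definition colrev (v : V) : V := (v.1, rev_ord v.2).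
Definition antitransp (v : V) : V := (rev_ord v.2, rev_ord v.1).
Definition halfturn (v : V) : V := (rev_ord v.1, rev_ord v.2).

Lemma grid_eq (u v : V) : u.1 = v.1 :> nat -> u.2 = v.2 :> nat -> u = v.
Proof. by case: u v => [a b] [c d] /= /val_inj -> /val_inj ->. Qed.

Lemma edgeP (u v : V) : reflect
  ((u.1 = v.1 :> nat /\ (u.2.+1 = v.2 :> nat \/ v.2.+1 = u.2 :> nat)) \/
   (u.2 = v.2 :> nat /\ (u.1.+1 = v.1 :> nat \/ v.1.+1 = u.1 :> nat))) (e u v).
Proof.
have -> : e u v = (((u.1.+1 == v.1) || (v.1.+1 == u.1)) && (u.2 == v.2 :> nat)) ||
    ((u.1 == v.1 :> nat) && ((u.2.+1 == v.2) || (v.2.+1 == u.2))) by [].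
by apply: (iffP idP); lia.
Qed.

Lemma edge_sym : symmetric e.
Proof. by move=> u v; apply/edgeP/edgeP; lia. Qed.

Lemma edge_irr : irreflexive e.
Proof. by move=> u; apply/edgeP; lia. Qed.

Lemma transpK : involutive transp. Proof. by case. Qed.
Lemma colrevK : involutive colrev. Proof. by case=> a b; rewrite /colrev /= rev_ordK. Qed.
Lemma antitranspK : involutive antitransp.
Proof. by case=> a b; rewrite /antitransp /= !rev_ordK. Qed.
Lemma halfturnK : involutive halfturn.
Proof. by case=> a b; rewrite /halfturn /= !rev_ordK. Qed.

Lemma edge_transp u v : e (transp u) (transp v) = e u v.
Proof. by apply/edgeP/edgeP => /=; lia. Qed.

Lemma edge_colrev u v : e (colrev u) (colrev v) = e u v.
Proof.
case: u v => [a b] [c d]; have := ltn_ord b; have := ltn_ord d.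
by move=> ? ?; apply/edgeP/edgeP => /=; lia.
Qed.

Lemma edge_antitransp u v : e (antitransp u) (antitransp v) = e u v.
Proof.
case: u v => [a b] [c d]; have := ltn_ord a; have := ltn_ord b.
have := ltn_ord c; have := ltn_ord d.
by move=> ? ? ? ?; apply/edgeP/edgeP => /=; lia.
Qed.

Lemma edge_halfturn u v : e (halfturn u) (halfturn v) = e u v.
Proof.
case: u v => [a b] [c d]; have := ltn_ord a; have := ltn_ord b.
have := ltn_ord c; have := ltn_ord d.
by move=> ? ? ? ?; apply/edgeP/edgeP => /=; lia.
Qed.

Lemma transp_fixed (v : V) : (transp v == v) = (v.1 == v.2 :> nat).
Proof. by case: v => a b; rewrite xpair_eqE -!val_eqE /=; lia. Qed.

Lemma diag_indep : {in [set v | transp v == v] &, forall u v, ~~ e u v}.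
Proof. by move=> u v; rewrite !inE !transp_fixed => ? ?; apply/negP => /edgeP; lia. Qed.

Lemma card_diag : #|[set v | transp v == v]| = k.*2.+1.
Proof.
have -> : [set v | transp v == v] = [set (i, i) | i in 'I_(2 * k + 1)].
  apply/setP => -[a b]; rewrite inE; apply/eqP/imsetP => [[E _]|[i _ [-> ->]]] //.
  by exists a; rewrite ?E.
by rewrite card_imset => [|i j []//]; rewrite card_ord ; lia.
Qed.

Lemma antitransp_fixed (v : V) : (antitransp v == v) = (v.1 + v.2 == k.*2).
Proof.
case: v => a b; have := ltn_ord a; have := ltn_ord b.
by rewrite xpair_eqE -!val_eqE /= => ? ?; lia.
Qed.

Lemma dvdn_hole h : 2 ^ k %| num_npm_hole e h.
Proof.
rewrite (num_npm_holeE edge_sym edge_irr).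
rewrite (card_pm_classes h edge_irr transpK edge_transp diag_indep card_diag).
exact: dvdn_mull.
Qed.

(** The role of [tau] is played by the antidiagonal reflection; [h.1 != h.2] says that the hole is
    not the center, hence is moved by the transposition. *)
Lemma dvdn_hole_antidiag (h : V) : h.1 + h.2 = k.*2 -> h.1 != h.2 :> nat ->
  2 ^ k.+1 %| num_npm_hole e h.
Proof.
move=> ah dh; rewrite (num_npm_holeE edge_sym edge_irr).
apply: (dvdn_card_pm_twice edge_irr transpK edge_transp diag_indep card_diag
  antitranspK edge_antitransp).
- by move=> [].
- by apply/eqP; rewrite antitransp_fixed ah.
- by rewrite transp_fixed.
move=> u v /eqP + /eqP; rewrite !antitransp_fixed => ? ?.
by apply/negP => /edgeP; lia.
Qed.

Lemma hole_transp h : num_npm_hole e (transp h) = num_npm_hole e h.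
Proof. exact: (num_npm_hole_conj edge_sym edge_irr _ transpK edge_transp). Qed.

Lemma hole_colrev h : num_npm_hole e (colrev h) = num_npm_hole e h.
Proof. exact: (num_npm_hole_conj edge_sym edge_irr _ colrevK edge_colrev). Qed.

Lemma hole_antitransp h : num_npm_hole e (antitransp h) = num_npm_hole e h.
Proof. exact: (num_npm_hole_conj edge_sym edge_irr _ antitranspK edge_antitransp). Qed.

Lemma hole_rowrev (h : V) : num_npm_hole e (rev_ord h.1, h.2) = num_npm_hole e h.
Proof.
case: h => i j.
by rewrite -[LHS]hole_transp -[LHS]hole_colrev -[LHS]hole_transp /transp /colrev /= rev_ordK.
Qed.

Definition center : V := let i := Ordinal (ltac:(lia) : k < 2 * k + 1) in (i, i).

(** The non-central axis vertices fold onto a half axis and the other vertices onto a quadrant, each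
    time with a factor 4, so divisibility by [2 ^ k.+1] remains to be found in each part. *)
Lemma num_npm_center :
  (forall h : V, (h.1 == k :> nat) || (h.2 == k :> nat) -> h != center ->
    2 ^ k.+1 %| num_npm_hole e h) ->
  exists x, num_npm e = num_npm_hole e center + 2 ^ k.+3 * x.
Proof.
move=> hdiv; set a := num_npm_hole e.
have centerE (v : V) : (v == center) = (v.1 == k :> nat) && (v.2 == k :> nat).
  by case: v => x y; rewrite xpair_eqE -!val_eqE.
have bnd (v : V) : v.1 < 2 * k + 1 /\ v.2 < 2 * k + 1 by [].
rewrite num_npm_sum (bigD1 center) //= -/a.
rewrite (bigID (fun v : V => (v.1 == k :> nat) || (v.2 == k :> nat))) /=.
set A := \sum_(v | _) _; set B := \sum_(v | _) _.
have [x Ax] : exists x, A = 2 ^ k.+3 * x.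
  rewrite /A (sum_fold (g := transp)
    (Q := fun v => (v.1 == k :> nat) && (v.2 != k :> nat))) //; first last.
  - by move=> v /=; lia.
  - by move=> v /=; rewrite centerE; lia.
  - exact: hole_transp.
  - exact: transpK.
  rewrite (sum_fold (g := colrev)
    (Q := fun v => (v.1 == k :> nat) && (v.2 < k))) //; first last.
  - by move=> v /=; have := bnd v; lia.
  - by move=> v /=; have := bnd v; lia.
  - exact: hole_colrev.
  - exact: colrevK.
  suff /dvdnP[y ->] : 2 ^ k.+1 %| \sum_(v : V | (v.1 == k :> nat) && (v.2 < k)) a v.
    by exists y; rewrite !expnS; lia.
  apply: dvdn_sum => v vP; apply: hdiv; rewrite ?centerE; lia.
have [y By] : exists y, B = 2 ^ k.+3 * y.
  rewrite /B (sum_fold (g := colrev)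
    (Q := fun v => (v.1 != k :> nat) && (k < v.2))) //; first last.
  - by move=> v /=; have := bnd v; lia.
  - by move=> v /=; have := bnd v; rewrite centerE; lia.
  - exact: hole_colrev.
  - exact: colrevK.
  rewrite (sum_fold (g := fun v : V => (rev_ord v.1, v.2))
    (Q := fun v => (v.1 < k) && (k < v.2))) //; first last.
  - by move=> v /=; have := bnd v; lia.
  - by move=> v /=; have := bnd v; lia.
  - exact: hole_rowrev.
  - by case=> i j; rewrite /= rev_ordK.
  (* On the antidiagonal of the quadrant [2 ^ k.+1] comes from [dvdn_hole_antidiag]; off it, one
     factor 2 comes from folding along the antidiagonal. *)
  rewrite (bigID (fun v : V => v.1 + v.2 == k.*2)) /=.
  rewrite [X in _ + X](sum_fold (g := antitransp)
    (Q := fun v => [&& v.1 < k, k < v.2 & v.1 + v.2 < k.*2])) //; first last.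
  - by move=> v /=; have := bnd v; lia.
  - by move=> v /=; have := bnd v; lia.
  - exact: hole_antitransp.
  - exact: antitranspK.
  set S2 := \sum_(v | _) _; set S1 := \sum_(v | _) _.
  have /dvdnP[y1 ->] : 2 ^ k.+1 %| S1.
    apply: dvdn_sum => v vP; by apply: dvdn_hole_antidiag; move: vP => /=; lia.
  have /dvdnP[y2 ->] : 2 ^ k %| S2.
    apply: dvdn_sum => v vP; apply: dvdn_hole.
  by exists (y1 + y2); rewrite !expnS; lia.
by exists (x + y); rewrite Ax By mulnDr.
Qed.

End Grid.

(** * Parity of the number of vertices enclosed by a cycle *)

Section Curve.

Variable k : nat.
Local Notation V := ('I_(2 * k + 1) * 'I_(2 * k + 1))%type.
Local Notation e := (odd_grid k).
Variable (C : {set V}).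

Section Half.

Variable f : V -> V.
Hypothesis (fC : forall v, v \in C -> f v \in C) (fK : involutive f).
Hypothesis (fe : forall v, v \in C -> e v (f v)).

Lemma fC_iff v : (f v \in C) = (v \in C).
Proof. by apply/idP/idP => /fC; rewrite ?fK. Qed.

Lemma sum_mate (P : V -> nat) : \sum_(v in C) P v = \sum_(v in C) P (f v).
Proof.
rewrite (reindex_inj (inv_inj fK)) /=; apply: eq_bigl => v; exact: fC_iff.
Qed.

(** An edge with both ends in [Q] contributes twice to the right-hand sum, so modulo 2 only the
    edges leaving [Q] remain. *)
Lemma cut_parity (Q : pred V) :
  odd (\sum_(v in C) (Q v && ~~ Q (f v))) = odd (\sum_(v in C) Q v).
Proof.
have -> : \sum_(v in C) Q v =
    \sum_(v in C) (Q v && Q (f v)) + \sum_(v in C) (Q v && ~~ Q (f v)).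
  by rewrite -big_split /=; apply: eq_bigr => v _; case: (Q v); case: (Q (f v)).
rewrite oddD -[LHS]addFb; congr (_ (+) _).
have -> : \sum_(v in C) (Q v && Q (f v)) = #|[set v in C | Q v && Q (f v)]|.
  rewrite -sum1_card [RHS](eq_bigl (fun v => (v \in C) && (Q v && Q (f v)))).
    by rewrite big_mkcondr; apply: eq_bigr => v _; case: (Q v && _).
  by move=> v; rewrite inE.
rewrite (odd_card_invol (f := f)).
- rewrite eq_card0 // => v; rewrite !inE; apply/negbTE/andP => -[/andP[vC _] /eqP E].
  by have := fe vC; rewrite E edge_irr.
- by move=> v; rewrite !inE fK fC_iff => /and3P[-> -> ->].
- by move=> v _; rewrite fK.
Qed.

(* The number of edges [v -- f v] of [C] crossing the vertical line between the
   columns [j - 1] and [j] in row [i] or below. *)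
Definition lcut (i j : nat) : nat :=
  \sum_(v in C) [&& i <= v.1, v.2 == j :> nat & (f v).2.+1 == j].

Lemma mateP (v : V) : v \in C ->
  (v.1 = (f v).1 :> nat /\ (v.2.+1 = (f v).2 :> nat \/ (f v).2.+1 = v.2 :> nat)) \/
  (v.2 = (f v).2 :> nat /\ (v.1.+1 = (f v).1 :> nat \/ (f v).1.+1 = v.1 :> nat)).
Proof. by move=> /fe /edgeP. Qed.

Lemma lcut_mate i j :
  lcut i j = \sum_(v in C) [&& i <= v.1, v.2.+1 == j & (f v).2 == j :> nat].
Proof.
rewrite /lcut sum_mate; apply: eq_bigr => v vC; rewrite fK; congr nat_of_bool.
by move: (mateP vC); case: (f v) => c d; case: v {vC} => a b /=; lia.
Qed.

Lemma lcut_step i j :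
  lcut i j = lcut i.+1 j + \sum_(v in C) [&& v.1 == i :> nat, v.2 == j :> nat & (f v).2.+1 == j].
Proof. by rewrite /lcut -big_split /=; apply: eq_bigr => v vC; lia. Qed.

(** This is [cut_parity] for the part of column [j] from row [i] on: the edges leaving it go left,
    right or up. *)
Lemma column_parity i j : odd (\sum_(v in C) ((i <= v.1) && (v.2 == j :> nat))) =
  odd (lcut i j + lcut i j.+1 +
       \sum_(v in C) [&& v.1 == i :> nat, v.2 == j :> nat & (f v).1.+1 == i]).
Proof.
rewrite -cut_parity (lcut_mate i j.+1) /lcut -!big_split /=; congr odd.
by apply: eq_bigr => v vC; have := mateP vC; lia.
Qed.

Lemma quadrant_parity i j : odd (\sum_(v in C) ((i <= v.1) && (j <= v.2))) =
  odd (lcut i j + \sum_(v in C) [&& v.1 == i :> nat, j <= v.2 & (f v).1.+1 == i]).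
Proof.
rewrite -cut_parity /lcut -!big_split /=; congr odd.
by apply: eq_bigr => v vC; have := mateP vC; lia.
Qed.

(** In the checkerboard colouring the diagonal is even, so [f] matches odd vertices above the
    diagonal with even ones above or on it. Only the last sum depends on [f], so it is the same for
    a matching and its mirror image. *)
Lemma color_balance :
  \sum_(v in C) (odd (v.1 + v.2) && (v.1 < v.2)) =
  \sum_(v in C) (~~ odd (v.1 + v.2) && (v.1 < v.2)) +
  \sum_(v in C) ((v.1 == v.2 :> nat) && ((f v).1 < (f v).2)).
Proof.
rewrite sum_mate -big_split /=; apply: eq_bigr => v vC.
by have := mateP vC; lia.
Qed.

End Half.

Variables (m : V -> V).
Hypothesis (mC : forall v, v \in C -> m v \in C) (mK : involutive m).
Hypothesis (me : forall v, v \in C -> e v (m v)).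
Hypothesis (tC : forall v, v \in C -> transp v \in C).

Let m' v := transp (m (transp v)).

Let m'C v : v \in C -> m' v \in C.
Proof. by move=> vC; do 2!apply/tC || apply/mC; apply: tC. Qed.

Let m'K : involutive m'.
Proof. by move=> v; rewrite /m' transpK mK transpK. Qed.

Let m'e v : v \in C -> e v (m' v).
Proof. by move=> vC; rewrite /m' -edge_transp transpK; apply: me; apply: tC. Qed.

Lemma sum_transp (P : V -> nat) : \sum_(v in C) P v = \sum_(v in C) P (transp v).
Proof. exact: (sum_mate tC (@transpK k)). Qed.

(* The vertex [(i, j)], if it is not on the closed curve formed by the [m]- and
   [m']-edges of [C], is enclosed by it iff [inside i.+1 j.+1]: ray crossing. *)
Definition inside (i j : nat) : bool := odd (lcut m i j + lcut m' i j).

(** The [m]-edges leaving the quadrant at (i, j) upward are the transposes of the [m']-edges counted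
    by [lcut m' j i], and likewise with [m] and [m'] exchanged. The two instances of
    [quadrant_parity] have the same left side. *)
Lemma inside_sym (i j : nat) : inside i j = inside j i.
Proof.
have q := quadrant_parity mC mK me i j; have q' := quadrant_parity m'C m'K m'e i j.
rewrite [X in odd (_ + X)]sum_transp in q; rewrite [X in odd (_ + X)]sum_transp in q'.
have E : \sum_(v in C) [&& (transp v).1 == i :> nat, j <= (transp v).2 & (m (transp v)).1.+1 == i]
   = lcut m' j i by apply: eq_bigr => v _; congr nat_of_bool; exact: andbCA.
have E' : \sum_(v in C) [&& (transp v).1 == i :> nat, j <= (transp v).2 & (m' (transp v)).1.+1 == i]
   = lcut m j i by apply: eq_bigr => v _; congr nat_of_bool; rewrite /m' transpK; exact: andbCA.
rewrite E in q; rewrite E' in q'; rewrite /inside; move: q q'; lia.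
Qed.

(** For horizontal neighbours, [column_parity] has the same left side for [m] and [m'], so the
    crossings of the two rays agree modulo 2; for vertical neighbours the rays differ by one row. In
    both cases an exceptional edge would end at [w'], which is not in [C]. *)
Lemma inside_edge (v w : V) : v \notin C -> w \notin C -> e v w ->
  inside v.1.+1 v.2.+1 = inside w.1.+1 w.2.+1.
Proof.
suff H (v' w' : V) : v' \notin C -> w' \notin C ->
    (v'.1 = w'.1 :> nat /\ v'.2.+1 = w'.2 :> nat) \/
    (v'.2 = w'.2 :> nat /\ v'.1.+1 = w'.1 :> nat) ->
    inside v'.1.+1 v'.2.+1 = inside w'.1.+1 w'.2.+1.
  move=> vC wC /edgeP vw.
  by case: vw => -[E []] F; [|apply/esym| |apply/esym]; apply: H => //; rewrite E F; auto.
move=> {}vC {}wC [[E1 E2]|[E2 E1]].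
  have z (f : V -> V) : (forall u, u \in C -> f u \in C) -> (forall u, u \in C -> e u (f u)) ->
      \sum_(u in C) [&& u.1 == v'.1.+1 :> nat, u.2 == w'.2 :> nat & (f u).1.+1 == v'.1.+1] = 0.
    move=> fC fe; apply: big1 => u uC; case B : [&& _, _ & _] => //.
    have := fC _ uC; rewrite (_ : f u = w') ?(negPf wC) //.
    by have := mateP fe uC => F; apply: grid_eq; coord_lia.
  have q := column_parity mC mK me v'.1.+1 w'.2.
  have q' := column_parity m'C m'K m'e v'.1.+1 w'.2.
  rewrite z // in q; rewrite z // in q'.
  by move: q q'; rewrite /inside -E1 -E2; lia.
have z (f : V -> V) : (forall u, u \in C -> f u \in C) -> (forall u, u \in C -> e u (f u)) ->
    \sum_(u in C) [&& u.1 == v'.1.+1 :> nat, u.2 == v'.2.+1 :> nat & (f u).2.+1 == v'.2.+1] = 0.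
  move=> fC fe; apply: big1 => u uC; case B : [&& _, _ & _] => //.
  have := fC _ uC; rewrite (_ : f u = w') ?(negPf wC) //.
  by have := mateP fe uC => ?; apply: grid_eq; coord_lia.
by rewrite /inside (lcut_step m) (lcut_step m') !z // -E1 -E2 !addn0.
Qed.

Lemma inside_diag t :
  inside t t = odd (\sum_(v in C) ((v.1 == v.2 :> nat) && (v.1 < t))).
Proof.
elim: t => [|t IH].
  rewrite /inside /lcut !big1 // => v _; rewrite ?andbF //; lia.
have -> : \sum_(v in C) ((v.1 == v.2 :> nat) && (v.1 < t.+1)) =
    \sum_(v in C) ((v.1 == v.2 :> nat) && (v.1 < t)) +
    \sum_(v in C) ((v.1 == t :> nat) && (v.2 == t :> nat)).
  by rewrite -big_split /=; apply: eq_bigr => v _; lia.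
rewrite oddD -IH.
have side (f : V -> V) : (forall u, u \in C -> f u \in C) -> involutive f ->
    (forall u, u \in C -> e u (f u)) ->
    odd (\sum_(v in C) ((t <= v.1) && (v.2 == t :> nat))) =
    odd (lcut f t t + lcut f t.+1 t.+1 +
      \sum_(v in C) (((v.1 == t :> nat) && (v.2 == t :> nat)) *
        (((f v).1.+1 == t) + ((f v).2 == t.+1 :> nat)))).
  move=> fC fK fe; rewrite (column_parity fC fK fe) (lcut_step f t t.+1).
  rewrite -!addnA; congr odd; congr (_ + (_ + _)).
  rewrite [X in X + _](sum_mate fC fK) -big_split /=; apply: eq_bigr => v vC.
  by have := mateP fe vC; rewrite fK; lia.
have q := side _ mC mK me; have q' := side _ m'C m'K m'e.
set s := \sum_(v in C) (_ * _) in q; set s' := \sum_(v in C) (_ * _) in q'.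
(* Transposition exchanges up with left and right with down, so exactly one of the two mates of the
   diagonal vertex lies above it or to its right. *)
have -> : \sum_(v in C) ((v.1 == t :> nat) && (v.2 == t :> nat)) = s + s'.
  rewrite /s /s' -big_split /=; apply: eq_bigr => v vC.
  case: andP => [[/eqP v1 /eqP v2]|]; last by rewrite !mul0n.
  rewrite /m' (_ : transp v = v) /=; last by apply: grid_eq; rewrite /= ?v1 ?v2.
  by clear -me vC v1 v2; have := mateP me vC; coord_lia.
by move: q q'; rewrite /inside; lia.
Qed.

(** The enclosed vertices other than [h] are matched among themselves by [m], so their number is
    even. Transposition permutes them, so the number of those on the diagonal is even as well. *)
Lemma even_between (h : V) : (forall v, v != h -> e v (m v)) -> m h = h -> transp h = h ->
  h \notin C ->
  ~~ odd #|[set v | [&& transp v == v, v != h, v \notin C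
      & odd (\sum_(u in C) ((u.1 == u.2 :> nat) && (u.1 < v.1)))]]|.
Proof.
move=> mh hh th hC.
pose E := [set v : V | (v \notin C) && inside v.1.+1 v.2.+1].
have evenE : ~~ odd #|E :\ h|.
  rewrite (odd_card_invol (f := m)).
  - rewrite eq_card0 // => v; rewrite !inE; apply/negbTE/andP => -[/andP[vh _] /eqP E1].
    by have := mh _ vh; rewrite E1 edge_irr.
  - move=> v; rewrite !inE => /and3P[vh vC vi].
    have mvC : m v \notin C by apply: contra vC => /mC; rewrite mK.
    rewrite mvC -(inside_edge vC mvC (mh _ vh)) vi !andbT.
    by apply: contra vh => /eqP E1; rewrite -(mK v) E1 hh.
  - by move=> v _; rewrite mK.
have tE v : transp v \in E = (v \in E).
  rewrite !inE inside_sym; congr (~~ _ && _).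
  by apply/idP/idP => /tC; rewrite ?transpK.
set S := [set v | _].
have hE : (h \in [set v in E | transp v == v]) = (h \in E) by rewrite [LHS]inE th eqxx andbT.
have ES : [set v in E | transp v == v] :\ h = S.
  apply/setP => v; rewrite !inE; case tv: (transp v == v); rewrite ?andbF //= andbT.
  case vh : (v == h) => //=; case vC: (v \in C) => //=.
  have v12 : v.2 = v.1 :> nat by move: tv; rewrite transp_fixed => /eqP.
  (* [inside_diag] counts diagonal vertices [u] with [u.1 <= v.1]; equality is excluded because [v]
     is not in [C]. *)
  rewrite v12 inside_diag; congr odd; apply: eq_bigr => u uC; congr nat_of_bool.
  case u12 : (_ == _ :> nat) => //=.
  have : u.1 != v.1 :> nat; last by coord_lia.
  apply: contraFN vC => /eqP u1; rewrite (_ : v = u) //.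
  by apply: grid_eq; coord_lia.
have := odd_card_invol (S := E) (f := @transp k).
rewrite (cardsD1 h E) (cardsD1 h [set v in E | _]) hE ES !oddD (negPf evenE) addbF.
move=> H; suff : odd (h \in E) = odd (h \in E) (+) odd #|S|.
  by case: (odd (h \in E)); case: (odd _).
by apply: H => v; rewrite ?tE ?transpK.
Qed.

End Curve.

(** * Matchings whose hole is the center *)

Section Center.

Variable k : nat.
Local Notation V := ('I_(2 * k + 1) * 'I_(2 * k + 1))%type.
Local Notation e := (odd_grid k).
Local Notation h := (center k).
Local Notation M := (pm e (~: [set h])).
Local Notation D := [set v : V | transp v == v].

Definition up (v : V) : bool := v.1 < v.2.

(* Alternates along the diagonal once the center is removed. *)
Definition pattern (v : V) : bool := odd v.1 (+) (k < v.1).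

Lemma in_diag (v : V) : (v \in D) = (v.1 == v.2 :> nat).
Proof. by rewrite inE transp_fixed. Qed.

Lemma center_diag : h \in D.
Proof. by rewrite in_diag. Qed.

Lemma diag_eq (u v : V) : u \in D -> v \in D -> u.1 = v.1 :> nat -> u = v.
Proof. by rewrite !in_diag => /eqP u12 /eqP v12 E; apply: grid_eq => //; rewrite -u12 E. Qed.

Lemma sum_diag_pair (C : {set V}) (p q : V) (P : V -> bool) : q != p ->
  C :&: D = [set p; q] ->
  \sum_(v in C) ((v.1 == v.2 :> nat) && P v) = P p + P q.
Proof.
move=> qp E; transitivity (\sum_(v in C :&: D) P v).
  rewrite [RHS](eq_bigl (fun v => (v \in C) && (v \in D))).
    by rewrite big_mkcondr; apply: eq_bigr => v _; rewrite in_diag; case: (_ == _).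
  by move=> v; rewrite in_setI.
by rewrite E big_setU1 ?big_set1 // inE eq_sym.
Qed.

Lemma card_between_ord (N p q : nat) : \sum_(i < N) (p < i < q) = minn N q - p.+1.
Proof. by elim: N => [|N IH]; rewrite ?big_ord0 ?big_ord_recr /= ?IH; lia. Qed.

Lemma card_diag_between (p q : nat) : q < 2 * k + 1 ->
  #|[set v in D | (v != h) && (p < v.1 < q)]| + (p < k < q) = q - p.+1.
Proof.
move=> qn; have := card_between_ord (2 * k + 1) p q; rewrite (minn_idPr (ltnW qn)) => <-.
have -> : \sum_(i < 2 * k + 1) (p < i < q) = #|[set v in D | p < v.1 < q]|.
  have -> : [set v in D | p < v.1 < q] = [set (i, i) | i in [set i : 'I_(2 * k + 1) | p < i < q]].
    apply/setP => -[a b]; rewrite !inE transp_fixed /=; apply/andP/imsetP.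
      by move=> [/eqP /val_inj <- ab]; exists a; rewrite ?inE.
    by move=> [i]; rewrite inE => ? [-> ->].
  rewrite card_imset => [|i j []//]; rewrite -sum1_card [RHS]big_mkcond /=.
  by apply: eq_bigr => i _; rewrite inE; case: ifP.
rewrite [RHS](cardsD1 h) addnC; congr (_ + _).
  by rewrite !inE transp_fixed eqxx.
by apply: eq_card => v; rewrite !inE andbCA.
Qed.

Lemma pm_center (m : {ffun V -> V}) : m \in M -> m h = h.
Proof. by move=> mM; apply/eqP; rewrite (holeP (@edge_irr k) _ mM). Qed.

Lemma transp_center : transp h = h. Proof. by []. Qed.

Lemma odd_between (x y z : nat) : y != z ->
  ~~ ((x == y) || (x == z)) && odd ((y < x) + (z < x)) = (minn y z < x < maxn y z).
Proof. by move=> yz; case: (ltngtP x y); case: (ltngtP x z) => /=; lia. Qed.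

Lemma parity_between (p q c : nat) : p != q -> p != k -> q != k ->
  c + (minn p q < k < maxn p q) = maxn p q - (minn p q).+1 -> ~~ odd c ->
  odd q (+) (k < q) = ~~ (odd p (+) (k < p)).
Proof.
wlog lt : p q / p < q => [H pq pk qk E oc|].
  have /orP[lt|lt] : (p < q) || (q < p) by lia.
    exact: H.
  rewrite minnC maxnC eq_sym in E pq; have := H q p lt pq qk pk E oc.
  by case: (odd p); case: (odd q); case: (k < p); case: (k < q).
rewrite (minn_idPl (ltnW lt)) (maxn_idPr (ltnW lt)) => _ pk qk E oc.
have -> : odd q = odd (c + (p < k < q) + p.+1) by rewrite E subnK.
rewrite !oddD /= (negPf oc) /= oddb.
have -> : (p < k < q) = (k < p) (+) (k < q).
  by case: (ltngtP k p) pk => // pk _; case: (ltngtP k q) qk => //= qk _; lia.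
by case: (odd p); case: (k < p); case: (k < q).
Qed.

Section Pair.

Variables (m : {ffun V -> V}) (p q : V).
Hypothesis (mM : m \in M) (pD : p \in D) (qp : q != p) (hp : h \notin comp (@transp k) m p).
Hypothesis pair_eq : comp (@transp k) m p :&: D = [set p; q].

Let C := comp (@transp k) m p.

Let qCD : q \in C /\ q \in D.
Proof. by apply/setIP; rewrite pair_eq !inE eqxx orbT. Qed.

Let mC v : v \in C -> m v \in C.
Proof. by case/(stableP _ _ _ (stable_comp (@transpK k) mM pD) v). Qed.

Let tC v : v \in C -> transp v \in C.
Proof. by case/(stableP _ _ _ (stable_comp (@transpK k) mM pD) v). Qed.

Let me v : v \in C -> e v (m v).
Proof. by move=> vC; apply: (pm_adj mM); apply: contraNneq hp => <-. Qed.

(** By [even_between], an even number of non-central diagonal vertices lies strictly between [p] and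
    [q], so a colouring that alternates along the punctured diagonal separates them. *)
Lemma pattern_pair : pattern q = ~~ pattern p.
Proof.
have := even_between mC (pm_inv mM) me tC (fun v => @pm_adj _ _ _ _ v mM)
  (pm_center mM) transp_center hp.
have [qC qD] := qCD; have ph : p != h by apply: contraNneq hp => <-; apply: mem_comp.
have qh : q != h by apply: contraNneq hp => <-.
have pC : p \in C by apply: mem_comp.
have pq1 : p.1 != q.1 :> nat by apply: contra_neq qp => E; apply: diag_eq.
have ph1 : p.1 != k :> nat by apply: contra_neq ph => E; apply: diag_eq; rewrite ?center_diag.
have qh1 : q.1 != k :> nat by apply: contra_neq qh => E; apply: diag_eq; rewrite ?center_diag.
have E : #|[set v | [&& transp v == v, v != h, v \notin C &
           odd (\sum_(u in C) ((u.1 == u.2 :> nat) && (u.1 < v.1)))]]| =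
  #|[set v in D | (v != h) && (minn p.1 q.1 < v.1 < maxn p.1 q.1)]|.
  apply: eq_card => v; rewrite [LHS]in_set [RHS]in_set [v \in D]in_set (sum_diag_pair _ qp pair_eq).
  case vD: (transp v == v) => //=; congr (_ && _).
  have : (v \in C) = (v == p) || (v == q).
    by have := in_setI v C D; rewrite pair_eq in_set2 [v \in D]inE vD andbT => ->.
  have -> : (v == p) = (v.1 == p.1 :> nat).
    by apply/eqP/eqP => [->//|]; apply: diag_eq; rewrite // inE.
  have -> : (v == q) = (v.1 == q.1 :> nat).
    by apply/eqP/eqP => [->//|]; apply: diag_eq; rewrite // inE.
  by move=> ->; apply: odd_between.
rewrite E => even_c; apply: parity_between even_c => //.
by apply: card_diag_between; rewrite gtn_max !ltn_ord.
Qed.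

(** By [color_balance], [m] and its mirror image match equally many of [p] and [q] upward; since
    they take opposite directions at each of the two, this number is one. *)
Lemma up_pair : up (m q) = ~~ up (m p).
Proof.
pose m' v := transp (m (transp v)).
have m'C v : v \in C -> m' v \in C by move=> vC; apply/tC/mC/tC.
have m'K : involutive m' by move=> v; rewrite /m' transpK (pm_inv mM) transpK.
have m'e v : v \in C -> e v (m' v).
  by move=> vC; rewrite /m' -edge_transp transpK; apply/me/tC.
have := color_balance mC (pm_inv mM) me; rewrite (color_balance m'C m'K m'e).
have [qC qD] := qCD; have pC : p \in C by apply: mem_comp.
rewrite !(sum_diag_pair _ qp pair_eq) => /addnI.
have tp : transp p = p by move: pD; rewrite inE => /eqP.
have tq : transp q = q by move: qD; rewrite inE => /eqP.
rewrite /m' tp tq /up /=.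
have := mateP me pC; have := mateP me qC; move: pD qD; rewrite !in_diag; coord_lia.
Qed.

End Pair.

Lemma comp_pair (m : {ffun V -> V}) p : m \in M -> p \in D -> p != h ->
  h \notin comp (@transp k) m p /\
  exists2 q, q != p & comp (@transp k) m p :&: D = [set p; q].
Proof.
move=> mM pD ph; have := comp_fixed (@edge_irr k) (@transpK k) mM pD.
case: ifP => // hp /setP/(_ h).
by rewrite in_setI hp center_diag !inE eq_sym (negPf ph).
Qed.

Definition patterned : {set {ffun V -> V}} :=
  [set m in M | [forall v in D, (v != h) ==> (up (m v) == pattern v)]].

Lemma patternedP m :
  reflect (m \in M /\ forall v, v \in D -> v != h -> up (m v) = pattern v) (m \in patterned).
Proof.
rewrite [_ \in patterned]in_set; apply: (iffP andP) => -[mM H]; split=> //.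
  by move=> v vD vh; have := forall_inP H _ vD; rewrite vh => /eqP.
by apply/forall_inP => v vD; apply/implyP => vh; rewrite H.
Qed.

Lemma up_transp (m : {ffun V -> V}) v : m \in M -> v \in D -> v != h ->
  up (transp (m v)) = ~~ up (m v).
Proof.
move=> mM vD vh; have /edgeP := pm_adj mM vh; move: vD.
by rewrite in_diag /up /=; coord_lia.
Qed.

(** The patterned matchings form a transversal of the flip classes. A flip reverses the direction at
    every axis point of the flipped set, so two patterned matchings of one class coincide. *)
Lemma card_center : #|M| = #|patterned| * 2 ^ k.
Proof.
apply: (card_pm_transversal (@edge_irr k) (@transpK k) (@edge_transp k) (@diag_indep k) (card_diag k)).
- by apply/subsetP => m /patternedP[].
- move=> m N /patternedP[mM mP] /patternedP[NM NP] /imsetP[X Xm NE].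
  have [sX hX _] := flippableP _ _ _ _ Xm.
  rewrite NE (_ : X = set0) ?flip0 //.
  rewrite (flippable_cover (@transpK k) mM Xm) (_ : X :&: D = set0) ?imset0 /cover ?big_set0 //.
  apply/setP => v; rewrite in_set0; apply/negbTE/negP => /setIP[vX vD].
  have vh : v != h by apply: contraNneq hX => <-.
  have := NP v vD vh; rewrite NE ffunE vX -(mP v vD vh).
  have -> : transp v = v by apply/eqP; rewrite inE in vD.
  by rewrite up_transp //; case: (up _).
move=> m mM.
(* Flipping the components of the diagonal vertices that violate the pattern repairs them all: by
   [up_pair] and [pattern_pair], both diagonal vertices of a component violate it or neither
   does. *)
pose W := [set p in D | (p != h) && (up (m p) != pattern p)].
pose X := \bigcup_(p in W) comp (@transp k) m p.
have WP p : p \in W -> [/\ p \in D, p != h & up (m p) != pattern p].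
  by rewrite [_ \in W]in_set => /andP[? /andP[? ?]]; split.
have Xm : X \in flippable (@transp k) h m.
  apply/flippableP; split.
  - apply/stableP => v /bigcupP[p pW vp]; have [pD _ _] := WP _ pW.
    have [? ?] := stableP _ _ _ (stable_comp (@transpK k) mM pD) _ vp.
    by split; apply/bigcupP; exists p.
  - apply/bigcupP => -[p pW]; apply/negP; have [pD ph _] := WP _ pW.
    by have [] := comp_pair mM pD ph.
  - apply/bigcupsP => p pW; have [pD _ _] := WP _ pW; exact: bigcup_sup.
have [sX hX _] := flippableP _ _ _ _ Xm.
exists (flip (@transp k) X m); last by apply: imset_f.
apply/patternedP; split; first exact: (flip_pm (@edge_irr k) (@transpK k) (@edge_transp k)).
move=> v vD vh; rewrite ffunE; case: ifP => vX.
  have -> : transp v = v by apply/eqP; rewrite inE in vD.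
  rewrite up_transp //.
  have /bigcupP[p pW vp] := vX; have [pD ph pw] := WP _ pW.
  have [hp [q qp E]] := comp_pair mM pD ph.
  have : v \in [set p; q] by rewrite -E in_setI vp vD.
  case/set2P=> ->; first by move: pw; case: (up _); case: (pattern _).
  rewrite (up_pair mM pD qp hp E) (pattern_pair mM pD qp hp E).
  by move: pw; case: (up _); case: (pattern _).
apply: contraFeq vX => w; apply/bigcupP; exists v; last exact: mem_comp.
by rewrite [_ \in W]in_set vD vh.
Qed.

End Center.

Import GRing.Theory.

(** * Parity of the number of matchings of the upper region *)

Section Parity.

Variables (V : finType) (e : rel V).
Hypothesis (e_sym : symmetric e) (e_irr : irreflexive e).
Variable Z : {set V}.

(* The identity outside [Z], so that only permutations of [Z] contribute to the
   determinant. *)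
Definition adj (u v : V) : bool := if u \in Z then (v \in Z) && e u v else u == v.

Lemma adj_sym u v : adj u v = adj v u.
Proof.
rewrite /adj; case: ifP => uZ; case: ifP => vZ //=.
- by apply/esym/eqP => E; rewrite E uZ in vZ.
- by apply/eqP => E; rewrite E vZ in uZ.
Qed.

Local Notation N := #|V|.

Definition adj_perms : {set 'S_N} :=
  [set s : 'S_N | [forall i, adj (enum_val i) (enum_val (s i))]].

Local Open Scope ring_scope.

Definition adj_mx : 'M['F_2]_N := \matrix_(i, j) (adj (enum_val i) (enum_val j))%:R.

Lemma F2_natr (n : nat) : (n%:R == 0 :> 'F_2) = ~~ odd n.
Proof. by rewrite -(dvdn_pcharf (pchar_Fp (isT : prime 2))) dvdn2. Qed.

Lemma F2_addxx (x : 'F_2) : x + x = 0.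
Proof. by rewrite -mulr2n -mulr_natr (eqP (_ : 2%:R == 0 :> 'F_2)) ?mulr0 // F2_natr. Qed.

Lemma F2_opp (x : 'F_2) : - x = x.
Proof. by apply/eqP; rewrite eq_sym -addr_eq0 F2_addxx. Qed.

Lemma det_adj_mx : \det adj_mx = #|adj_perms|%:R.
Proof.
rewrite /determinant -sum1_card natr_sum [RHS]big_mkcond /=; apply: eq_bigr => s _.
have -> : (-1) ^+ s = 1 :> 'F_2 by rewrite F2_opp expr1n.
rewrite mul1r inE; case: ifP => [/forallP sA|/negbT].
  by rewrite big1 // => i _; rewrite mxE sA.
rewrite negb_forall => /existsP[i iA]; rewrite (bigD1 i) //= mxE (negPf iA).
by rewrite mul0r.
Qed.

(* A permutation and its inverse are both counted, so only involutions matter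
   modulo 2. *)
Lemma odd_adj_perms : odd #|adj_perms| = odd #|pm e Z|.
Proof.
rewrite (odd_card_invol (f := fun s : 'S_N => s^-1%g)); first last.
- by move=> s _; rewrite invgK.
- move=> s; rewrite !inE => /forallP sA; apply/forallP => i.
  by have := sA (s^-1%g i); rewrite permKV adj_sym.
pose c (s : 'S_N) := [ffun u => enum_val (s (enum_rank u))].
have cinj : injective c.
  move=> s t /ffunP E; apply/permP => i; apply: enum_val_inj.
  by have := E (enum_val i); rewrite !ffunE enum_valK.
rewrite -(card_imset _ cinj); congr odd; apply: eq_card => m.
apply/imsetP/idP => [[s] | mP].
  rewrite !inE => /andP[/forallP sA /eqP sV] ->.
  apply/forallP => u; rewrite !ffunE enum_valK -{1}sV permK enum_rankK eqxx /=.
  by have := sA (enum_rank u); rewrite enum_rankK /adj; case: ifP => _; [case/andP | rewrite eq_sym].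
have [mK mZ mN] := pmP _ _ _ mP.
have inj : injective (fun i : 'I_N => enum_rank (m (enum_val i))).
  by move=> i j /enum_rank_inj /(can_inj mK) /enum_val_inj.
have pE i : perm inj i = enum_rank (m (enum_val i)) by rewrite permE.
exists (perm inj).
  rewrite !inE; apply/andP; split.
    apply/forallP => i; rewrite pE enum_rankK /adj; case: ifP => vZ.
      by rewrite (pm_inset e_irr _ mP) vZ mZ.
    by rewrite mN ?vZ.
  apply/eqP/permP => i; apply: (@perm_inj _ (perm inj)); rewrite permKV !pE enum_rankK mK.
  by rewrite enum_valK.
by apply/ffunP => u; rewrite ffunE pE !enum_rankK.
Qed.

(** Signs vanish in characteristic 2, so by [odd_adj_perms] the parity is the determinant of the
    symmetric matrix [adj_mx], which is nonzero when the kernel is trivial. *)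
Lemma odd_card_pm :
  (forall f : V -> 'F_2, (forall v, v \notin Z -> f v = 0) ->
     (forall v, v \in Z -> \sum_(w in Z | e v w) f w = 0) -> forall v, f v = 0) ->
  odd #|pm e Z|.
Proof.
move=> ker; rewrite -odd_adj_perms -[odd _]negbK -F2_natr -det_adj_mx.
apply/negP => /det0P[x x0 xA]; move/eqP: x0; apply.
pose f u := x 0 (enum_rank u).
have sumA w : \sum_u f u * (adj u w)%:R = 0.
  have := congr1 (fun y : 'rV_N => y 0 (enum_rank w)) xA; rewrite !mxE => E; rewrite -[RHS]E {E}.
  rewrite [RHS](reindex _ (onW_bij _ (@enum_rank_bij V))) /=.
  by apply: eq_bigr => u _; rewrite mxE !enum_rankK.
suff f0 v : f v = 0.
  by apply/rowP => i; rewrite mxE -(enum_valK i) -/(f _) f0.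
apply: ker => {}v vZ.
  rewrite -[RHS](sumA v) (bigD1 v) //= {1}/adj (negPf vZ) eqxx mulr1 big1 ?addr0 // => u uv.
  by rewrite adj_sym /adj (negPf vZ) eq_sym (negPf uv) mulr0.
rewrite -[RHS](sumA v) [LHS]big_mkcond /=; apply: eq_bigr => u _.
by rewrite adj_sym /adj vZ; case: ifP => _; rewrite ?mulr1 ?mulr0.
Qed.

End Parity.

(** * Patterned matchings as pairs of matchings of a region *)

Section Region.

Variable k : nat.
Local Notation V := ('I_(2 * k + 1) * 'I_(2 * k + 1))%type.
Local Notation e := (odd_grid k).
Local Notation h := (center k).
Local Notation M := (pm e (~: [set h])).
Local Notation D := [set v : V | transp v == v].

(** The diagonal vertices included are those that a patterned matching joins upward, so such a
    matching never leaves this set. *)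
Definition region : {set V} :=
  [set v : V | up v || [&& v.1 == v.2 :> nat, v.1 != k :> nat & pattern v]].

(** On the diagonal the half turn sends i to 2k - i, which keeps the parity and changes the side of
    k, so it negates [pattern]. *)
Lemma region_halfturn v : v != h -> (halfturn v \in region) = (v \notin region).
Proof.
move=> vh; have : ~~ ((v.1 == k :> nat) && (v.2 == k :> nat)).
  by apply: contra vh => /andP[/eqP v1 /eqP v2]; apply/eqP/grid_eq.
case: v {vh} => a b; have := ltn_ord a; have := ltn_ord b.
rewrite !inE /up /pattern /=; move: (nat_of_ord a) (nat_of_ord b) => x y xk yk xy.
case: (ltngtP x y) xy => [lt|lt|<-] xy.
- by rewrite /=; lia.
- by rewrite /=; lia.
rewrite andbb in xy; rewrite (negPf xy) eqxx /= ltnn /=.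
have -> : (2 * k + 1 - x.+1 != k) = true by lia.
have -> : odd (2 * k + 1 - x.+1) = odd x by lia.
have -> : (k < 2 * k + 1 - x.+1) = ~~ (k < x) by lia.
by case: (odd x); case: (k < x).
Qed.

Lemma center_region : h \notin region.
Proof. by rewrite inE /up /= ltnn !eqxx. Qed.

Lemma halfturn_center : halfturn h = h.
Proof. by apply: grid_eq => /=; lia. Qed.

Lemma region_diag v : v \in D -> v != h -> (v \in region) = pattern v.
Proof.
move=> vD vh; rewrite inE /up; have v12 := vD; rewrite in_diag in v12.
have -> : (v.1 != k :> nat) by apply: contra_neq vh => E; apply: diag_eq; rewrite ?center_diag.
by rewrite v12 (eqP v12) ltnn.
Qed.

Lemma region_mate m v : m \in patterned k -> v \in region -> m v \in region.
Proof.
move=> /patternedP[mM mP] vR.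
have vh : v != h by apply: contraTneq vR => ->; apply: center_region.
have ev := pm_adj mM vh.
have mvh : m v != h by apply: contra_neq vh => E; rewrite -(pm_inv mM v) E pm_center.
case vD : (v \in D).
  have := mP v vD vh; rewrite -region_diag // vR => mu.
  by rewrite inE mu.
have vU : up v.
  move: vR; rewrite inE => /orP[//|/andP[]].
  by rewrite in_diag in vD; rewrite vD.
case mD : (m v \in D).
  by rewrite region_diag // -mP // (pm_inv mM).
rewrite inE; apply/orP; left; move: ev vU mD => /edgeP; rewrite in_diag /up; coord_lia.
Qed.

Definition restrict (m : {ffun V -> V}) : {ffun V -> V} :=
  [ffun v => if v \in region then m v else v].

Lemma restrict_pm m : m \in patterned k -> restrict m \in pm e region.
Proof.
move=> mY; have /patternedP[mM mP] := mY; apply/pmP; split=> v.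
- rewrite !ffunE; case vR: (v \in region); last by rewrite vR.
  by rewrite region_mate // (pm_inv mM).
- by move=> vR; rewrite ffunE vR (pm_adj mM) //; apply: contraTneq vR => ->; apply: center_region.
- by move=> vR; rewrite ffunE (negPf vR).
Qed.

Definition rotate (m : {ffun V -> V}) : {ffun V -> V} :=
  [ffun v => halfturn (m (halfturn v))].

Lemma up_halfturn (v : V) : up (halfturn v) = (v.2 < v.1).
Proof.
case: v => a b; rewrite /up /=; have := ltn_ord a; have := ltn_ord b.
by move: (nat_of_ord a) (nat_of_ord b) => x y; lia.
Qed.

Lemma halfturn_neq (v : V) : (halfturn v == h) = (v == h).
Proof. by rewrite -{1}halfturn_center (inj_eq (inv_inj (@halfturnK k))). Qed.

Lemma halfturn_diag (v : V) : (halfturn v \in D) = (v \in D).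
Proof.
rewrite !in_diag; case: v => a b /=; have := ltn_ord a; have := ltn_ord b.
by move: (nat_of_ord a) (nat_of_ord b) => x y; lia.
Qed.

Lemma off_diag_mate (m : {ffun V -> V}) v : m \in M -> v \in D -> v != h ->
  (m v).1 != (m v).2 :> nat.
Proof.
by move=> mM vD vh; have /edgeP := pm_adj mM vh; move: vD; rewrite in_diag; coord_lia.
Qed.

Lemma rotate_patterned m : m \in patterned k -> rotate m \in patterned k.
Proof.
move=> /patternedP[mM mP]; apply/patternedP; split.
  apply/pmP; split=> v; rewrite ?inE !ffunE.
  - by rewrite halfturnK (pm_inv mM) halfturnK.
  - by move=> vh; rewrite -{1}(halfturnK v) edge_halfturn (pm_adj mM) // halfturn_neq.
  - by rewrite negbK => /eqP ->; rewrite halfturn_center pm_center // halfturn_center.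
move=> v vD vh; rewrite ffunE up_halfturn.
have hD : halfturn v \in D by rewrite halfturn_diag.
have hh : halfturn v != h by rewrite halfturn_neq.
have := off_diag_mate mM hD hh; have := mP _ hD hh.
rewrite -region_diag // region_halfturn // region_diag // /up.
by case: (ltngtP (m (halfturn v)).1 (m (halfturn v)).2) => // _; case: (pattern v).
Qed.

Definition glue (ms : {ffun V -> V} * {ffun V -> V}) : {ffun V -> V} :=
  [ffun v => if v \in region then ms.1 v else halfturn (ms.2 (halfturn v))].

Lemma glue_patterned m1 m2 : m1 \in pm e region -> m2 \in pm e region ->
  glue (m1, m2) \in patterned k.
Proof.
move=> m1P m2P; have [K1 Z1 N1] := pmP _ _ _ m1P; have [K2 Z2 N2] := pmP _ _ _ m2P.
have gh : glue (m1, m2) h = h.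
  by rewrite ffunE (negPf center_region) /= halfturn_center N2 ?center_region // halfturn_center.
have out v : v \notin region -> v != h -> halfturn (m2 (halfturn v)) \notin region.
  move=> vR vh; have hR : halfturn v \in region by rewrite region_halfturn.
  have m2R : m2 (halfturn v) \in region by rewrite (pm_inset (@edge_irr k) _ m2P).
  rewrite region_halfturn ?m2R //.
  by apply: contraTneq m2R => ->; apply: center_region.
have gR v : v \in region -> glue (m1, m2) v = m1 v by move=> vR; rewrite ffunE vR.
have gN v : v \notin region -> glue (m1, m2) v = halfturn (m2 (halfturn v)).
  by move=> vR; rewrite ffunE (negPf vR).
have gM : glue (m1, m2) \in M.
  apply/pmP; split=> v.
  - case: (boolP (v \in region)) => vR.
      by rewrite (gR v) // gR ?K1 // (pm_inset (@edge_irr k) _ m1P).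
    have [->|vh] := eqVneq v h; first by rewrite !gh.
    by rewrite (gN v) // gN ?out // halfturnK K2 halfturnK.
  - rewrite !inE => vh; case: (boolP (v \in region)) => vR; first by rewrite gR ?Z1.
    by rewrite gN // -{1}(halfturnK v) edge_halfturn Z2 // region_halfturn.
  - by rewrite !inE negbK => /eqP ->.
apply/patternedP; split=> // v vD vh; have := off_diag_mate gM vD vh.
rewrite -region_diag //; case: (boolP (v \in region)) => vR.
  rewrite gR // => od; have : m1 v \in region by rewrite (pm_inset (@edge_irr k) _ m1P).
  by rewrite inE (negPf od) orbF.
rewrite gN // => od; have : m2 (halfturn v) \in region.
  by rewrite (pm_inset (@edge_irr k) _ m2P) region_halfturn.
rewrite up_halfturn inE /up; move: od => /=; set w := m2 _.
have := ltn_ord w.1; have := ltn_ord w.2.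
by move: (nat_of_ord w.1) (nat_of_ord w.2) (pattern w) => x y b; case: b; lia.
Qed.

(** A patterned matching splits into its restrictions to the region and to the half turn of the
    region; [glue] is the inverse construction. *)
Lemma card_patterned : #|patterned k| = #|pm e region| ^ 2.
Proof.
rewrite -mulnn -cardsX -(@card_in_imset _ _ glue).
  apply: eq_card => m; apply/idP/imsetP => [mY|[[m1 m2] /setXP[? ?] ->]]; last exact: glue_patterned.
  exists (restrict m, restrict (rotate m)).
    by apply/setXP; rewrite !restrict_pm ?rotate_patterned.
  have /patternedP[mM _] := mY.
  apply/ffunP => v; rewrite !ffunE /=; case: ifPn => vR; first by rewrite vR.
  have [->|vh] := eqVneq v h.
    by rewrite halfturn_center (negPf center_region) halfturn_center pm_center.
  by rewrite region_halfturn // vR !halfturnK.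
move=> [m1 m2] [n1 n2] /setXP[/pmP[_ _ N1] /pmP[_ _ N2]] /setXP[/pmP[_ _ N1'] /pmP[_ _ N2']].
move=> /ffunP E; congr pair; apply/ffunP => v.
  case vR: (v \in region); last by rewrite N1 ?N1' ?vR.
  by have := E v; rewrite !ffunE vR.
case vR: (v \in region); last by rewrite N2 ?N2' ?vR.
have vh : v != h by apply: contraTneq vR => ->; apply: center_region.
have := E (halfturn v); rewrite !ffunE region_halfturn // vR /= halfturnK.
exact: inv_inj (@halfturnK k) _ _.
Qed.

End Region.

(** * Triviality of the kernel through the discrete wave equation *)

Section Kernel.

Variable k : nat.
Local Notation V := ('I_(2 * k + 1) * 'I_(2 * k + 1))%type.
Local Notation e := (odd_grid k).
Local Notation h := (center k).

Local Open Scope ring_scope.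

Lemma two_step (g : nat -> 'F_2) : exists phi : nat -> 'F_2,
  [/\ phi 0%N = 0, phi 1%N = 0 & forall i, phi i.+2 = phi i + g i.+1].
Proof.
(* The iteration carries the pair of consecutive values at [i] and [i.+1]. *)
by exists (fun i => (iteri i (fun j p => (p.2, p.1 + g j.+1)) (0, 0)).1); split.
Qed.

Variable f : V -> 'F_2.
Hypothesis f_out : forall v, v \notin region k -> f v = 0.
Hypothesis f_ker : forall v, v \in region k -> \sum_(w in region k | e v w) f w = 0.

(* The values of [f] with coordinates shifted to start at 1, extended by 0. *)
Definition ext (a b : nat) : 'F_2 :=
  \sum_(w : V | (w.1.+1 == a :> nat) && (w.2.+1 == b :> nat)) f w.

Lemma ext_vertex (v : V) : ext v.1.+1 v.2.+1 = f v.
Proof.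
by rewrite /ext (eq_bigl (pred1 v)) ?big_pred1_eq.
Qed.

Lemma ext0 b : ext 0 b = 0.
Proof. by rewrite /ext big_pred0. Qed.

Lemma ext_last a : ext a (2 * k + 2) = 0.
Proof.
rewrite /ext big_pred0 // => w; apply/negbTE; have := ltn_ord w.2.
by move: (nat_of_ord w.2) => x; lia.
Qed.

Lemma ext_lower a b : (b < a)%N -> ext a b = 0.
Proof.
move=> ba; apply: big1 => w /andP[/eqP w1 /eqP w2]; apply: f_out.
rewrite inE /up; move: w1 w2; move: (nat_of_ord w.1) (nat_of_ord w.2) (pattern w).
by move=> x y c; lia.
Qed.

Lemma sum_neighbors (v : V) : \sum_(w | e v w) f w =
  ext v.1 v.2.+1 + ext v.1.+2 v.2.+1 + ext v.1.+1 v.2 + ext v.1.+1 v.2.+2.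
Proof.
have extE a b : ext a b = \sum_(w : V) f w *+ ((w.1.+1 == a :> nat) && (w.2.+1 == b :> nat)).
  by rewrite /ext big_mkcond; apply: eq_bigr => w _; case: (_ && _).
rewrite !extE big_mkcond -!big_split /=; apply: eq_bigr => w _.
rewrite -!mulrnDr (_ : (if e v w then f w else 0) = f w *+ e v w); last by case: (e v w).
congr (_ *+ _).
have -> : e v w = [|| (w.1.+1 == v.1) && (w.2.+1 == v.2.+1), (w.1.+1 == v.1.+2) && (w.2.+1 == v.2.+1),
    (w.1.+1 == v.1.+1) && (w.2.+1 == v.2) | (w.1.+1 == v.1.+1) && (w.2.+1 == v.2.+2)]%N.
  by apply/edgeP/idP; coord_lia.
by move: (nat_of_ord w.1) (nat_of_ord w.2) (nat_of_ord v.1) (nat_of_ord v.2) => x y a b; lia.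
Qed.

Lemma region_harmonic (v : V) : v \in region k ->
  ext v.1 v.2.+1 + ext v.1.+2 v.2.+1 + ext v.1.+1 v.2 + ext v.1.+1 v.2.+2 = 0.
Proof.
move=> vR; rewrite -sum_neighbors -[RHS](f_ker vR) [RHS]big_mkcondl /=.
by apply: eq_bigr => w _; case: ifPn => // /f_out.
Qed.

Lemma upper_harmonic i j : (i < j < 2 * k + 1)%N ->
  ext i j.+1 + ext i.+2 j.+1 + ext i.+1 j + ext i.+1 j.+2 = 0.
Proof.
move=> /andP[ij jn]; have iN := ltn_trans ij jn.
apply: (@region_harmonic (Ordinal iN, Ordinal jn)).
by rewrite inE /up /= ij.
Qed.

(** The first row and the vanishing last column give the d'Alembert form; the equations on and below
    the diagonal then force [psi] to vanish at even and odd arguments separately. *)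
Lemma region_kernel v : f v = 0.
Proof.
have [phi [phi0 phi1 phiS]] := two_step (ext 1).
(* The reflection about [2 * k + 2] makes [psi (b - a) + psi (a + b)] vanish in the boundary column
   [b = 2 * k + 2], as [ext] does. *)
pose psi i := if (i <= 2 * k + 2)%N then phi i else phi (4 * k + 4 - i)%N.
have psi_sym i : (i <= 4 * k + 4)%N -> psi (4 * k + 4 - i)%N = psi i.
  move=> iN; rewrite /psi; case: leqP => c1; case: leqP => c2 //; try by congr phi; lia.
have psiS i : (i.+2 <= 2 * k + 2)%N -> psi i.+2 = psi i + ext 1 i.+1.
  by move=> iN; rewrite /psi iN phiS ifT //; lia.
(* The wave equation is of second order, so the induction carries two consecutive rows; the boundary
   column is treated apart by the symmetry of [psi]. *)
have dAlembert a : forall b, (a <= b <= 2 * k + 2)%N -> ext a b = psi (b - a)%N + psi (a + b)%N.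
  suff [] : (forall b, (a <= b <= 2 * k + 2)%N -> ext a b = psi (b - a)%N + psi (a + b)%N) /\
    (forall b, (a.+1 <= b <= 2 * k + 2)%N -> ext a.+1 b = psi (b - a.+1)%N + psi (a.+1 + b)%N) by [].
  elim: a => [|a [IH0 IH1]].
    split=> b bN; first by rewrite ext0 subn0 add0n F2_addxx.
    have [bl|bl] := eqVneq b (2 * k + 2)%N.
      rewrite bl ext_last -(psi_sym (1 + (2 * k + 2))%N); last by lia.
      by rewrite (_ : (4 * k + 4 - _)%N = (2 * k + 2 - 1)%N) ?F2_addxx //; lia.
    case: b bN bl => // b bN bl; rewrite subSS subn0 add1n psiS; last by lia.
    by rewrite addrA F2_addxx add0r.
  split=> // b bN; have [bl|bl] := eqVneq b (2 * k + 2)%N.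
    rewrite bl ext_last -(psi_sym (a.+2 + (2 * k + 2))%N); last by lia.
    by rewrite (_ : (4 * k + 4 - _)%N = (2 * k + 2 - a.+2)%N) ?F2_addxx //; lia.
  case: b bN bl => // b bN bl; have := @upper_harmonic a b ltac:(lia).
  rewrite IH0 ?IH1; [|lia..].
  rewrite (_ : b.+2 - a.+1 = b.+1 - a)%N; last by lia.
  rewrite (_ : a.+1 + b = a + b.+1)%N; last by lia.
  rewrite (_ : a.+1 + b.+2 = a.+2 + b.+1)%N; last by lia.
  rewrite (_ : b - a.+1 = b.+1 - a.+2)%N; last by lia.
  set x := psi (b.+1 - a)%N; set y := psi (a + b.+1)%N.
  set z := psi (b.+1 - a.+2)%N; set t := psi (a.+2 + b.+1)%N => E.
  apply/eqP; rewrite -subr_eq0 F2_opp; apply/eqP.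
  (* Both [x] and [y] occur twice in [E], so they cancel in characteristic 2. *)
  rewrite -[RHS]E -[LHS]addr0 -[X in _ + X](F2_addxx x) -[LHS]addr0 -[X in _ + X](F2_addxx y); ring.
have psi0 : psi 0%N = 0 by [].
have psi1 : psi 1%N = 0 by rewrite /psi ifT //; lia.
have diag_vertex i : (i < 2 * k + 1)%N -> exists2 u : V, u.1 = i :> nat & u.2 = i :> nat.
  by move=> iN; exists (Ordinal iN, Ordinal iN).
(* For [i != k], exactly one of the diagonal vertices [i] and [2 * k - i] lies in the region. *)
have mirror (P : nat -> Prop) :
    (forall u : V, u.1 = u.2 :> nat -> u.1 != k :> nat -> u \in region k -> P u.1) ->
    (forall i, (i < 2 * k + 1)%N -> P (2 * k - i)%N -> P i) ->
    forall i, (i < 2 * k + 1)%N -> i != k -> P i.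
  move=> Pin Pm i iN ik; have [u u1 u2] := diag_vertex i iN.
  have u12 : u.1 = u.2 :> nat by rewrite u1 u2.
  have uh : u != h by apply: contra_neq ik => E; rewrite -u1 E.
  case: (boolP (u \in region k)) => uR; first by rewrite -u1; apply: Pin; rewrite ?u1.
  apply: Pm => //; have hu1 : (halfturn u).1 = (2 * k - i)%N :> nat by rewrite /= u1; lia.
  rewrite -hu1; apply: Pin; rewrite ?region_halfturn // ?hu1; last by lia.
  by rewrite /= -u12 u1; lia.
(* These are the values of [f] on the diagonal, which vanish outside the region; a diagonal vertex
   of the region has its half turn outside, with the same value of [psi] by symmetry. *)
have even0 i : (i < 2 * k + 1)%N -> psi i.+1.*2 = 0.
  move=> iN; have [u u1 u2] := diag_vertex i iN.
  have psiE (w : V) : w.1 = w.2 :> nat -> psi w.1.+1.*2 = f w.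
    move=> w12; rewrite -ext_vertex -w12 dAlembert ?subnn ?psi0 ?add0r ?addnn //.
    by have := ltn_ord w.1; lia.
  have u12 : u.1 = u.2 :> nat by rewrite u1 u2.
  case: (boolP (u \in region k)) => uR; last by rewrite -u1 psiE // f_out.
  have uh : u != h by apply: contraTneq uR => ->; apply: center_region.
  have uR' : halfturn u \notin region k by rewrite region_halfturn // uR.
  have := psiE (halfturn u); rewrite (f_out uR') => <-; last by rewrite /= u12.
  rewrite -[LHS]psi_sym; last by lia.
  by congr psi; rewrite /= u1; lia.
(* In the equation at a diagonal vertex of the region, two neighbours lie below the diagonal and
   [psi 1 = 0], so only these two values remain. *)
have odd_const i : (i < 2 * k + 1)%N -> i != k -> psi i.*2.+1 = psi i.*2.+3.
  move: i; apply: mirror => [u u12 uk uR|i iN E].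
    have := region_harmonic uR; rewrite -u12 (@ext_lower u.1.+2) // (@ext_lower u.1.+1) //.
    rewrite !addr0; have := ltn_ord u.1 => uN.
    rewrite !dAlembert; [|lia..].
    rewrite (_ : u.1.+1 - u.1 = 1)%N ?psi1 ?add0r; last by lia.
    rewrite (_ : u.1.+2 - u.1.+1 = 1)%N ?psi1 ?add0r; last by lia.
    rewrite (_ : u.1 + u.1.+1 = u.1.*2.+1)%N; last by lia.
    rewrite (_ : u.1.+1 + u.1.+2 = u.1.*2.+3)%N; last by lia.
    by move/eqP; rewrite addr_eq0 F2_opp => /eqP.
  rewrite -[LHS]psi_sym; last by lia.
  rewrite -[RHS]psi_sym; last by lia.
  rewrite (_ : 4 * k + 4 - i.*2.+1 = (2 * k - i).*2.+3)%N; last by lia.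
  by rewrite (_ : 4 * k + 4 - i.*2.+3 = (2 * k - i).*2.+1)%N; last by lia.
have odd0 i : (i <= k)%N -> psi i.*2.+1 = 0.
  elim: i => [|i IH] ik; first exact: psi1.
  by rewrite doubleS -odd_const ?IH //; lia.
have psi_eq0 i : (i <= 4 * k + 4)%N -> psi i = 0.
  move=> iN; rewrite -(odd_double_half i); move: (i./2) (odd_double_half i) => j.
  case: (odd i) => /= ji; rewrite ?add1n ?add0n in ji *.
    have [jk|jk] := leqP j k; first exact: odd0.
    rewrite -[LHS]psi_sym; last by lia.
    rewrite (_ : 4 * k + 4 - j.*2.+1 = (2 * k + 1 - j).*2.+1)%N; last by lia.
    by apply: odd0; lia.
  case: j ji => [|j] ji; first exact: psi0.
  have [jk|jk] := ltnP j (2 * k + 1)%N; first exact: even0.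
  rewrite -[LHS]psi_sym; last by lia.
  rewrite (_ : 4 * k + 4 - j.+1.*2 = 0)%N; last by lia.
  exact: psi0.
have [up_v|low_v] := leqP v.1 v.2.
  rewrite -ext_vertex dAlembert ?psi_eq0 ?addr0 //; have := ltn_ord v.2; try lia.
by rewrite -ext_vertex ext_lower.
Qed.

End Kernel.

(** * The congruence modulo 8 *)

Lemma odd_region k : odd #|pm (odd_grid k) (region k)|.
Proof.
apply: odd_card_pm; [exact: edge_sym | exact: edge_irr |].
by move=> f f_out f_ker v; apply: region_kernel.
Qed.

Theorem theorem4 (k : nat) (hk : 1 <= k)
  (hdiv : forall h : 'I_(2 * k + 1) * 'I_(2 * k + 1),
     h \in central_row k :|: central_column k -> ~~ is_center h ->
     2 ^ k.+1 %| num_npm_hole (odd_grid k) h) :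
  exists c : nat,
    num_npm (odd_grid k) = 2 ^ k * c /\ c = 1 %[mod 8].
Proof.
have [h ax hc|x ->] := @num_npm_center k.
  by apply: hdiv; [rewrite !inE | apply: contra hc => /andP[/eqP ? /eqP ?]; apply/eqP/grid_eq].
rewrite (num_npm_holeE (@edge_sym k) (@edge_irr k)) card_center card_patterned.
have := odd_region k; set r := #|_| => r_odd.
(* The 8 is what remains of [2 ^ k.+3] after [2 ^ k] is factored out. *)
exists (r ^ 2 + x * 8); split; first by rewrite !expnS; lia.
(* With r = 2q + 1 the square is 4q(q + 1) + 1, and q(q + 1) is even. *)
have -> : r ^ 2 = (r./2 * r./2.+1)./2 * 8 + 1.
  have : ~~ odd (r./2 * r./2.+1) by rewrite oddM /=; case: (odd _).
  have : r = r./2.*2.+1 by rewrite -[LHS]odd_double_half r_odd.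
  by move: (r./2) => q -> /even_halfK; nia.
by rewrite addnAC -mulnDl modnMDl.
Qed.
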